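(* Let $\psi$ be the time $2\pi$ map of a Hamiltonian isotopy of $D^2$ generated by a $2\pi$-periodic Hamiltonian function $H_s\colon D^2\to\mathbb{R}$, $s\in\mathbb{R}/2\pi\mathbb{Z}$. If the Hamiltonian function is autonomous (i.e. independent of $s$) on a collar neighbourhood of $\partial D^2$ and depends only on the radial coordinate $r$ in that neighbourhood, then $\psi$ embeds into a Reeb flow on $S^3$.
   Context: $D^2$ is the closed unit disc with polar coordinates $(r,\theta)$ and area form $\omega=2r\,\mathrm{d}r\wedge\mathrm{d}\theta$; $H_s$ is smooth in all variables and its Hamiltonian vector field $X_s$ is defined by $\omega(X_s,\cdot)=\mathrm{d}H_s$. Global surface of section for the flow of a smooth non-singular vector field $X$ on a closed $3$-manifold $M$: an embedded compact surface $\Sigma\subset M$ such that each component of $\partial\Sigma$ is a periodic orbit of $X$, $\mathrm{Int}(\Sigma)$ is transverse to $X$, and the orbit of $X$ through any point of $M\setminus\partial\Sigma$ meets $\mathrm{Int}(\Sigma)$ in forward and backward time. The Poincaré return map on $\mathrm{Int}(\Sigma)$ sends $p$ to the first intersection point in forward time of its flow line with $\mathrm{Int}(\Sigma)$. An area-preserving diffeomorphism $\psi\colon\Sigma\to\Sigma$ ''embeds into a Reeb flow on $M$'' if it can be realised, on $\mathrm{Int}(\Sigma)$, as the Poincaré return map on a global surface of section for the Reeb flow of some contact form on the closed $3$-manifold $M$. Here the identification of $\Sigma$ with the surface of section is a topological embedding $\Sigma\hookrightarrow M$ that is a smooth embedding on $\mathrm{Int}(\Sigma)$ and whose image is a smoothly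 embedded surface with boundary (smoothness of the parametrisation at $\partial\Sigma$ is not required). *)

(* Defs.v *)
From HB Require Import structures.
From mathcomp Require Import all_boot all_order all_algebra.
From mathcomp Require Import all_classical all_reals all_analysis.

Set Implicit Arguments.
Unset Strict Implicit.
Unset Printing Implicit Defensive.

Import Order.TTheory GRing.Theory Num.Theory.
Import numFieldNormedType.Exports.
Local Open Scope classical_set_scope.
Local Open Scope ring_scope.

Section Smoothness.
Context {R : realType}.

(* Meaningful for U open and V finite-dimensional. *)
Fixpoint Ck (k : nat) {V W : normedModType R} (U : set V) (f : V -> W) : Prop :=
  if k is k'.+1 then
    (forall x, U x -> differentiable f x) /\ (forall v, Ck k' U ('D_v f))
  else forall x, U x -> {for x, continuous f}.

Definition smooth {V W : normedModType R} (U : set V) (f : V -> W) : Prop :=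
  forall k, Ck k U f.

(* On an arbitrary subset A: local extendability to smooth maps on open sets.
   For a closed disc this is smoothness up to the boundary. *)
Definition smooth_on {V W : normedModType R} (A : set V) (f : V -> W) : Prop :=
  forall x, A x -> exists (U : set V) (g : V -> W),
    [/\ open U, U x, smooth U g & forall y, A y -> U y -> g y = f y].

(* L is the differential of f at p relative to A; it is unique when A is the
   closed disc, including at boundary points. *)
Definition is_diff_within {V : normedModType R} (A : set V) (f : V -> R)
    (p : V) (L : V -> R) : Prop :=
  forall e : R, 0 < e ->
    \forall q \near within A (nbhs p),
      `|f q - f p - L (q - p)| <= e * `|q - p|.

Definition homeo_onto_image {V W : topologicalType} (A : set V) (f : V -> W) :=
  {within A, continuous f} /\
  exists g : W -> V,
    {within f @` A, continuous g} /\ forall x, A x -> g (f x) = x.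

End Smoothness.

(* The library norm `|v| on row vectors is the sup norm; Euclidean lengths
   below are expressed with dot. *)
Definition dot {R : realType} {n : nat} (u v : 'rV[R]_n) : R :=
  \sum_(i < n) u 0 i * v 0 i.

Section Disc.
Context {R : realType}.
Implicit Types (p u v : 'rV[R]_2) (psi : 'rV[R]_2 -> 'rV[R]_2).

Definition disc : set 'rV[R]_2 := [set p | dot p p <= 1].
Definition open_disc : set 'rV[R]_2 := [set p | dot p p < 1].
Definition circle : set 'rV[R]_2 := [set p | dot p p = 1].
Definition radius p : R := Num.sqrt (dot p p).

(* 2 r dr /\ dtheta = 2 dx /\ dy *)
Definition omega u v : R := 2 * (u 0 0 * v 0 1 - u 0 1 * v 0 0).

Definition diffeo_disc psi : Prop :=
  exists psi' : 'rV[R]_2 -> 'rV[R]_2,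
    [/\ smooth_on disc psi, smooth_on disc psi',
        forall p, disc p -> disc (psi p) /\ psi' (psi p) = p
      & forall p, disc p -> disc (psi' p) /\ psi (psi' p) = p].

Definition smooth_periodic_hamiltonian (H : R -> 'rV[R]_2 -> R) : Prop :=
  smooth_on [set z : R * 'rV[R]_2 | disc z.2] (fun z => H z.1 z.2) /\
  forall s p, disc p -> H (s + 2 * pi) p = H s p.

Definition hamiltonian_vector_field (H : R -> 'rV[R]_2 -> R)
    (X : R -> 'rV[R]_2 -> 'rV[R]_2) : Prop :=
  forall s p, disc p -> is_diff_within disc (H s) p (omega (X s p)).

Definition hamiltonian_isotopy (H : R -> 'rV[R]_2 -> R)
    (phi : R -> 'rV[R]_2 -> 'rV[R]_2) : Prop :=
  [/\ smooth_on [set z : R * 'rV[R]_2 | disc z.2] (fun z => phi z.1 z.2),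
      forall s, diffeo_disc (phi s),
      forall p, disc p -> phi 0 p = p
    & exists2 X, hamiltonian_vector_field H X
      & forall s p, disc p -> is_derive s (1 : R) (phi^~ p) (X s (phi s p))].

Definition autonomous_radial_near_boundary (H : R -> 'rV[R]_2 -> R) : Prop :=
  exists (e : R) (h : R -> R), [/\ 0 < e, e < 1
    & forall s p, disc p -> 1 - e < radius p -> H s p = h (radius p)].

End Disc.

Section ThreeSphere.
Context {R : realType}.
Implicit Types (a X : 'rV[R]_4 -> 'rV[R]_4) (p q u v w : 'rV[R]_4).
Implicit Types (Phi : R -> 'rV[R]_4 -> 'rV[R]_4) (S B : set 'rV[R]_4).

Definition sphere3 : set 'rV[R]_4 := [set p | dot p p = 1].
Definition tangent3 p : set 'rV[R]_4 := [set v | dot p v = 0].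

(* A map a : R^4 -> R^4 encodes the 1-form \sum_i a_i dx_i. *)
Definition form1 a p v : R := dot (a p) v.
Definition dform1 a p u v : R := dot ('D_u a p) v - dot ('D_v a p) u.
Definition wedge_d a p u v w : R :=
  form1 a p u * dform1 a p v w + form1 a p v * dform1 a p w u
  + form1 a p w * dform1 a p u v.

(* Every smooth 1-form on S^3 is the restriction of one defined near S^3, and
   restriction commutes with d; the 3-form alpha /\ d alpha is nonzero at p iff
   it is nonzero on some triple of tangent vectors. *)
Definition contact_form a : Prop :=
  (exists U : set 'rV[R]_4, [/\ open U, sphere3 `<=` U & smooth U a]) /\
  forall p, sphere3 p -> exists u v w,
    [/\ tangent3 p u, tangent3 p v, tangent3 p w & wedge_d a p u v w != 0].

Definition reeb_field a X : Prop :=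
  forall p, sphere3 p ->
    [/\ tangent3 p (X p), form1 a p (X p) = 1
      & forall v, tangent3 p v -> dform1 a p (X p) v = 0].

Definition flow_of X Phi : Prop :=
  forall p, sphere3 p -> Phi 0 p = p /\
    forall t, sphere3 (Phi t p) /\ is_derive t (1 : R) (Phi^~ p) (X (Phi t p)).

Definition orbit Phi p : set 'rV[R]_4 := range (Phi^~ p).

Definition periodic_orbit Phi (C : set 'rV[R]_4) : Prop :=
  exists p T, [/\ 0 < T, Phi T p = p & C = orbit Phi p].

(* S is a smoothly embedded surface with boundary B: slice charts F of R^4
   sending S to the half-plane {y0 >= 0, y2 = y3 = 0} and B to its edge. *)
Definition embedded_surface S B : Prop :=
  B `<=` S /\
  forall q, S q -> exists (U V : set 'rV[R]_4) (F G : 'rV[R]_4 -> 'rV[R]_4),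
    [/\ [/\ open U, open V & U q],
        smooth U F /\ smooth V G,
        forall x, U x -> V (F x) /\ G (F x) = x,
        forall y, V y -> U (G y) /\ F (G y) = y
      & forall x, U x ->
          (S x <-> [/\ 0 <= F x 0 0, F x 0 2 = 0 & F x 0 3 = 0]) /\
          (B x <-> [/\ F x 0 0 = 0, F x 0 2 = 0 & F x 0 3 = 0])].

(* Velocities of smooth curves in S; used at interior points of S. *)
Definition tangent_surface S p : set 'rV[R]_4 :=
  [set v | exists (U : set R) (c : R -> 'rV[R]_4),
    [/\ open U, U 0, smooth U c, (forall t, U t -> S (c t)) & c 0 = p]
    /\ is_derive (0 : R) (1 : R) c v].

Definition global_surface_of_section X Phi S B : Prop :=
  [/\ S `<=` sphere3 /\ compact S,
      embedded_surface S B,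
      forall p, B p -> periodic_orbit Phi (connected_component B p),
      forall p, (S `\` B) p -> ~ tangent_surface S p (X p)
    & forall p, (sphere3 `\` B) p ->
        (exists2 t : R, 0 < t & (S `\` B) (Phi t p)) /\
        (exists2 t : R, t < 0 & (S `\` B) (Phi t p))].

Definition first_return Phi (I : set 'rV[R]_4) p q : Prop :=
  I q /\ exists t : R, [/\ 0 < t, Phi t p = q
    & forall t', 0 < t' -> t' < t -> ~ I (Phi t' p)].

(* iota need not be smooth along the boundary circle. *)
Definition disc_embedding (iota : 'rV[R]_2 -> 'rV[R]_4) : Prop :=
  [/\ homeo_onto_image disc iota,
      smooth open_disc iota
    & forall w v : 'rV[R]_2, open_disc w -> 'D_v iota w = 0 -> v = 0].

Definition embeds_into_Reeb_flow_on_S3 (psi : 'rV[R]_2 -> 'rV[R]_2) : Prop :=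
  exists a X Phi (iota : 'rV[R]_2 -> 'rV[R]_4),
    let S := iota @` disc in
    let B := iota @` circle in
    [/\ [/\ contact_form a, reeb_field a X & flow_of X Phi],
        disc_embedding iota,
        global_surface_of_section X Phi S B
      & forall w : 'rV[R]_2, open_disc w ->
          first_return Phi (S `\` B) (iota w) (iota (psi w))].

End ThreeSphere.

(* Main.v *)
Require Import Defs.
From HB Require Import structures.
From mathcomp Require Import all_boot all_order all_algebra.
From mathcomp Require Import all_classical all_reals all_analysis.
From mathcomp Require Import ring lra.

(** In coordinates [z = (z1, z2)] on the 3-sphere, the complement of the circle
    [z2 = 0] is parametrised by [(s, w) |-> (w, sqrt (1 - |w|^2) e^(i s))], with
    [w] in the open disc. A Hamiltonian [K] that vanishes on the boundary circle
    gives the 1-form [r^2 dtheta + K ds], that is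
    [(x1 dy1 - y1 dx1) + G (x2 dy2 - y2 dx2)] with [G = K / (1 - |w|^2)]. If [K]
    is radial near the boundary, [G] is there a smooth function of [|z2|^2]
    (Hadamard's lemma), so the form is smooth on the whole sphere. The vector
    field [d/ds + X_s] annihilates its differential, and the form is contact as
    soon as [K + lambda(X) > 0], where [lambda = r^2 dtheta]. The Reeb flow is then
    the Hamiltonian flow up to a time change; the hemisphere [s = 0] is a surface of
    section whose return map is the time [2 pi] map of [K].

    Positivity and vanishing at the boundary are arranged by composing the given
    isotopy with the rotations by [N s]. For a natural number [N] this does not
    change the time [2 pi] map, replaces [H] by
    [N (1 - r^2) + H_s o rot(- N s)] up to a constant, and adds [N] to
    [H + lambda(X)], which is bounded. *)

Set Implicit Arguments.
Unset Strict Implicit.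
Unset Printing Implicit Defensive.

Import Order.TTheory GRing.Theory Num.Theory.
Import numFieldNormedType.Exports.
Local Open Scope classical_set_scope.
Local Open Scope ring_scope.

(** * Smooth maps *)

(** The rotation by [N s] has Hamiltonian [N (1 - r^2)], and [lambda] takes the value [N r^2] on its
    generator; the sum is the constant [N]. Hence the twist raises [K + lambda(X)] uniformly up to
    the boundary although its Hamiltonian vanishes there. The core circle [z2 = 0] imposes a
    condition of its own: with [K = f(1 - r^2)] near the boundary, [G] equals [f'(0)] on that
    circle, and the form is contact there when [f'(0) > 0]. So [N] must also outweigh the radial
    derivative of the given Hamiltonian at [r = 1]. The Hamiltonian is smooth up to the boundary
    only through local extensions, and the vector field and the radial profile come without any
    regularity. The geometry therefore takes place over the open disc, where [K] is smooth in the
    ordinary sense and [X] is recovered from [dK]. The price is a proof that the isotopy preserves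
    the open disc, obtained from a conserved quantity supported in the collar. No existence theorem
    for differential equations enters: the Reeb orbits are assembled from the given isotopy, one
    scalar time change per orbit. *)

Section Differentials.
Context {R : realType}.

(** This estimate and its converse below trade the little-o definition of the differential for the
    epsilon form in which [is_diff_within] is stated. *)
Lemma differentiable_near (V W : normedModType R) (f : V -> W) (x : V) :
  differentiable f x -> forall e : R, 0 < e ->
    \forall q \near x, `|f q - f x - 'd f x (q - x)| <= e * `|q - x|.
Proof.
move=> df e e0.
have /diff_locally/eqaddoP/(_ e e0) := df.
rewrite [\forall x \near _, _ <= _](near_shift x) => H; near=> q.
have nq : forall t, ((fun h : V =>
    `|(f \o shift x - (cst (f x) + 'd f x)) h| <= e * `|h|) \o shift (0 - x)) t ->
    `|f t - f x - 'd f x (t - x)| <= e * `|t - x|.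
  by move=> t; rewrite /= !fctE /= sub0r subrK opprD addrA.
by apply: nq; near: q.
Unshelve. all: by end_near. Qed.

Lemma near_differentiable (V W : normedModType R) (f : V -> W) (x : V)
    (L : {linear V -> W}) : continuous L ->
  (forall e : R, 0 < e ->
    \forall q \near x, `|f q - f x - L (q - x)| <= e * `|q - x|) ->
  differentiable f x /\ 'd f x = L :> (V -> W).
Proof.
move=> Lc H.
have fE : f \o shift x = cst (f x) + L +o_ 0 id.
  apply/eqaddoP => e e0; rewrite [\forall x \near _, _ <= _](near_shift x); near=> q.
  rewrite /= !fctE /= sub0r subrK opprD addrA; near: q; exact: H.
have dE := diff_unique Lc fE; split=> //.
by apply/diff_locallyP; rewrite dE; split.
Unshelve. all: by end_near. Qed.

Lemma near_eq_differentiable (V W : normedModType R) (f g : V -> W) (x : V) :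
  (\near x, f x = g x) -> differentiable f x -> differentiable g x.
Proof.
move=> fg df.
apply: (proj1 (@near_differentiable _ _ g x ('d f x) (diff_continuous df) _)) => e e0.
have H := differentiable_near df e0; near=> q.
by rewrite -(nbhs_singleton fg) -(near fg q) ?(near H q).
Unshelve. all: by end_near. Qed.

Lemma Ck_sub (V W : normedModType R) k (A B : set V) (f : V -> W) :
  A `<=` B -> Ck k B f -> Ck k A f.
Proof.
move=> AB; elim: k f => [|k IH] f /= fB; first by move=> x /AB; exact: fB.
by split=> [x /AB|v]; [exact: fB.1|exact/IH/fB.2].
Qed.

(** Derivatives depend only on germs, so on an open set an equality of functions passes to all their
    derivatives. This is how a derivative is replaced by an explicit formula valid only on [U]. *)
Lemma Ck_eq (V W : normedModType R) k (U : set V) (f g : V -> W) :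
  open U -> (forall x, U x -> f x = g x) -> Ck k U f -> Ck k U g.
Proof.
move=> oU.
have nearU (h1 h2 : V -> W) : (forall x, U x -> h1 x = h2 x) ->
    forall x, U x -> \near x, h1 x = h2 x.
  by move=> hh x Ux; near=> y; apply: hh; near: y; exact: open_nbhs_nbhs.
elim: k f g => [|k IH] f g fg /=.
  move=> cf x Ux; rewrite /prop_for /continuous_at -(fg _ Ux).
  by apply: cvg_trans (cf x Ux); apply: near_eq_cvg; exact: nearU.
move=> [df Df]; split=> [x Ux|v].
  exact: near_eq_differentiable (nearU _ _ fg x Ux) (df x Ux).
apply: (IH ('D_v f)); last exact: Df.
by move=> x Ux; apply: near_eq_derive; exact: nearU.
Unshelve. all: by end_near. Qed.

(** [Ck] is a pointwise condition on derivatives taken in the ambient space, so [A] can be any set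
    through the point. *)
Lemma Ck_local (V W : normedModType R) k (U : set V) (f : V -> W) :
  (forall x, U x -> exists A, A x /\ Ck k A f) -> Ck k U f.
Proof.
elim: k f => [|k IH] f /= H.
  by move=> x /H[A [Ax Af]]; exact: Af.
split=> [x /H[A [Ax [Af _]]]|v]; first exact: Af.
by apply: IH => x /H[A [Ax [_ Af]]]; exists A.
Qed.

Lemma CkW (V W : normedModType R) k (U : set V) (f : V -> W) :
  Ck k.+1 U f -> Ck k U f.
Proof.
elim: k f => [|k IH] f [df Df]; last by split=> // v; exact/IH/Df.
by move=> x /df; exact: differentiable_continuous.
Qed.

Lemma Ck_cst (V W : normedModType R) k (U : set V) (c : W) :
  Ck k U (fun _ : V => c).
Proof.
elim: k c => [|k IH] c; first by move=> x _; exact: cst_continuous.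
split=> [x _|v]; first exact: differentiable_cst.
rewrite (_ : 'D_v _ = fun _ => 0) //.
by apply/funext => x; exact: derive_cst.
Qed.

Lemma Ck_linear (V W : normedModType R) k (U : set V) (f : {linear V -> W}) :
  continuous f -> Ck k U f.
Proof.
case: k => [|k] cf; first by move=> x _; exact: cf.
split=> [x _|v]; first exact: linear_differentiable.
rewrite (_ : 'D_v _ = fun _ => f v); first exact: Ck_cst.
by apply/funext => x; rewrite deriveE ?diff_lin//; exact: linear_differentiable.
Qed.

Lemma CkD (V W : normedModType R) k (U : set V) (f g : V -> W) : open U ->
  Ck k U f -> Ck k U g -> Ck k U (fun x => f x + g x).
Proof.
move=> oU; elim: k f g => [|k IH] f g /=.
  by move=> cf cg x Ux; apply: cvgD; [exact: cf|exact: cg].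
move=> [df Df] [dg Dg]; split=> [x Ux|v].
  by apply: differentiableD; [exact: df|exact: dg].
apply: (@Ck_eq _ _ _ _ (fun x => 'D_v f x + 'D_v g x)) => //; last exact: IH.
by move=> x Ux; rewrite -[RHS]/('D_v (f + g) x) deriveD//; apply: diff_derivable;
  [exact: df|exact: dg].
Qed.

Lemma CkM (V : normedModType R) k (U : set V) (f g : V -> R) : open U ->
  Ck k U f -> Ck k U g -> Ck k U (fun x => f x * g x).
Proof.
move=> oU; elim: k f g => [|k IH] f g.
  by move=> cf cg x Ux; apply: cvgM; [exact: cf|exact: cg].
move=> fk gk; have [[df Df] [dg Dg]] := (fk, gk); split=> [x Ux|v].
  by apply: differentiableM; [exact: df|exact: dg].
apply: (@Ck_eq _ _ _ _ (fun x => f x * 'D_v g x + g x * 'D_v f x)) => //.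
  by move=> x Ux; rewrite -[RHS]/('D_v (f * g) x) deriveM//; apply: diff_derivable;
    [exact: df|exact: dg].
by apply: CkD => //; apply: IH; do ?[exact: CkW|exact: Df|exact: Dg].
Qed.

Lemma CkN (V : normedModType R) k (U : set V) (f : V -> R) : open U ->
  Ck k U f -> Ck k U (fun x => - f x).
Proof.
move=> oU fk; apply: (@Ck_eq _ _ _ _ (fun x => -1 * f x)) => //.
  by move=> x _; rewrite mulN1r.
by apply: CkM => //; exact: Ck_cst.
Qed.

Lemma CkB (V : normedModType R) k (U : set V) (f g : V -> R) : open U ->
  Ck k U f -> Ck k U g -> Ck k U (fun x => f x - g x).
Proof. by move=> oU fk gk; apply: CkD => //; exact: CkN. Qed.

Lemma CkX (V : normedModType R) k (U : set V) (f : V -> R) n : open U ->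
  Ck k U f -> Ck k U (fun x => f x ^+ n).
Proof.
move=> oU fk; elim: n => [|n IH].
  have fE : (fun x => f x ^+ 0) = (fun=> 1) by apply/funext => x; rewrite expr0.
  by rewrite fE; exact: Ck_cst.
apply: (@Ck_eq _ _ _ _ (fun x => f x * f x ^+ n)) => //; last exact: CkM.
by move=> x _; rewrite exprS.
Qed.

Lemma derive_scal1 (V : normedModType R) (f : R -> V) x v : derivable f x 1 ->
  'D_v f x = v *: 'D_1 f x.
Proof.
move=> /derivable1_diffP df; rewrite !deriveE//.
by rewrite -[X in 'd _ _ X = _]mulr1 -[v * 1]/(v *: 1) linearZ.
Qed.

(** Bootstrap in one variable: when [g'] is expressed through functions already known to be [Ck],
    one order is gained. The elementary functions below become smooth in this way. *)
Lemma Ck_derive1 k (I : set R) (g g' : R -> R) : open I ->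
  (forall x, I x -> is_derive x (1 : R) g (g' x)) ->
  Ck k I g' -> Ck k.+1 I g.
Proof.
move=> oI gg' g'k; split=> [x /gg' [+ _]|v]; first by move=> /derivable1_diffP.
apply: (@Ck_eq _ _ _ _ (fun x => v * g' x)) => //; last first.
  by apply: CkM => //; exact: Ck_cst.
by move=> x /gg'[dg <-]; rewrite [RHS]derive_scal1.
Qed.

Lemma Ck_comp1 (V : normedModType R) k (U : set V) (I : set R) (g : R -> R)
    (f : V -> R) : open U -> (forall x, U x -> I (f x)) ->
  Ck k I g -> Ck k U f -> Ck k U (fun x => g (f x)).
Proof.
move=> oU UI; elim: k g => [|k IH] g.
  by move=> gI fU x Ux; apply: continuous_comp; [exact: fU|exact/gI/UI].
move=> gI fU; have [[dg Dg] [df Df]] := (gI, fU); split=> [x Ux|v].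
  by apply: differentiable_comp; [exact: df|exact/dg/UI].
apply: (@Ck_eq _ _ _ _ (fun x => 'D_1 g (f x) * 'D_v f x)) => //.
  move=> x Ux; have dfx := df x Ux; have dgx := dg _ (UI _ Ux).
  transitivity ('D_('D_v f x) g (f x)).
    by rewrite [RHS]derive_scal1 1?mulrC//; exact/derivable1_diffP.
  have dgf : differentiable (g \o f) x by exact: differentiable_comp.
  rewrite -[RHS]/('D_v (g \o f) x) (deriveE _ dgx) (deriveE v dfx) (deriveE v dgf).
  by rewrite (diff_comp dfx dgx).
by apply: CkM; [|apply: (IH ('D_1 g)); [exact: Dg|exact: CkW]|exact: Df].
Qed.

Lemma smooth_inv k : Ck k [set x : R | x != 0] (fun x => x^-1).
Proof.
have oI : open [set x : R | x != 0] by exact: open_neq.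
elim: k => [|k IH]; first by move=> x x0; exact: inv_continuous.
apply: (@Ck_derive1 _ _ _ (fun x => - (x^-1 * x^-1))) => //.
  move=> x x0; have [dx eq] := @is_deriveV _ id x 1 1 x0 (is_derive_id _ _); split; first exact: dx.
  rewrite -[LHS]/('D_1 (fun y : R => (id y)^-1) x) eq /= -exprVn expr2 scaleNr.
  by congr (- _); exact: mulr1.
by apply: CkN => //; exact: CkM.
Qed.

Lemma CkV (V : normedModType R) k (U : set V) (f : V -> R) : open U ->
  (forall x, U x -> f x != 0) -> Ck k U f -> Ck k U (fun x => (f x)^-1).
Proof. by move=> oU f0; apply: Ck_comp1 oU f0 (@smooth_inv k). Qed.

Lemma smooth_sqrt k : Ck k [set x : R | 0 < x] (@Num.sqrt R).
Proof.
have oI : open [set x : R | 0 < x] by exact: open_gt.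
elim: k => [|k IH]; first by move=> x x0; exact: sqrt_continuous.
apply: (@Ck_derive1 _ _ _ (fun x => (2 * Num.sqrt x)^-1)) => //.
apply: CkV => //.
  by move=> x x0; rewrite mulf_neq0 ?pnatr_eq0// sqrtr_eq0 -ltNge.
by apply: CkM => //; exact: Ck_cst.
Qed.

Lemma smooth_trig k : Ck k setT (@cos R) /\ Ck k setT (@sin R).
Proof.
elim: k => [|k [IHc IHs]].
  by split=> x _; [exact: continuous_cos|exact: continuous_sin].
split; (eapply Ck_derive1; first exact: openT).
- by move=> x _; exact: is_derive_cos.
- by apply: CkN => //; exact: openT.
- by move=> x _; exact: is_derive_sin.
- by [].
Qed.

Lemma smooth_atan k : Ck k setT (@atan R).
Proof.
case: k => [|k]; first by move=> x _; exact: continuous_atan.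
eapply Ck_derive1; first exact: openT.
  by move=> x _; exact: is_derive1_atan.
apply: CkV; first exact: openT.
  by move=> x _; rewrite lt0r_neq0// ltr_pwDl// sqr_ge0.
apply: CkD; [exact: openT|exact: Ck_cst|apply: CkX; first exact: openT].
by apply: (@Ck_linear _ _ _ _ idfun) => x; exact: cvg_id.
Qed.

End Differentials.

(** * Maps into row vectors and the chain rule on a product *)

Section Rows.
Context {R : realType}.

Lemma row_sum n (v : 'rV[R]_n) : v = \sum_(i < n) v 0 i *: delta_mx 0 i.
Proof. by rewrite [LHS]matrix_sum_delta big_ord1. Qed.

Lemma continuous_rV (T : topologicalType) n (f : T -> 'rV[R]_n) (x : T) :
  (forall i, {for x, continuous (fun y => f y 0 i)}) -> {for x, continuous f}.
Proof.
move=> cf; apply/cvgrPdist_le => /= e e0; near=> y.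
rewrite /Num.Def.normr/= mx_normrE (bigmax_le _ (ltW e0))//= => -[i j] _.
rewrite !mxE/= ord1; move: j; near: y; apply: filter_forall => j.
by have /cvgrPdist_le/(_ _ e0) := cf j.
Unshelve. all: by end_near. Qed.

Lemma differentiable_rV (V : normedModType R) n (f : V -> 'rV[R]_n) (x : V) :
  (forall i, differentiable (fun y => f y 0 i) x) -> differentiable f x.
Proof.
move=> df.
have -> : f = \sum_(i < n) (fun y => f y 0 i *: (delta_mx 0 i : 'rV[R]_n)).
  by apply/funext => y; rewrite fct_sumE [LHS]row_sum.
by apply: differentiable_sum => i; exact: differentiableZl.
Qed.

Lemma derive_rV (V : normedModType R) n (f : V -> 'rV[R]_n) (x v : V) i :
  derivable f x v -> ('D_v f x) 0 i = 'D_v (fun y => f y 0 i) x.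
Proof. by move=> /derive_mx ->; rewrite mxE. Qed.

Lemma is_derive_rV (V : normedModType R) n (f : V -> 'rV[R]_n) (x v : V) (w : 'rV[R]_n) :
  (forall i, is_derive x v (fun y => f y 0 i) (w 0 i)) -> is_derive x v f w.
Proof.
move=> df.
have dfx : derivable f x v.
  by apply/derivable_mxP => i j; rewrite ord1; exact: ex_derive.
by split=> //; apply/rowP => i; rewrite derive_rV// derive_val.
Qed.

Lemma is_derive_coord (V : normedModType R) n (f : V -> 'rV[R]_n) (x v : V) (w : 'rV[R]_n) :
  is_derive x v f w -> forall i, is_derive x v (fun y => f y 0 i) (w 0 i).
Proof.
move=> [dfx <-] i; split; last by rewrite derive_rV.
by move/derivable_mxP : dfx; exact.
Qed.

Lemma Ck_coord (V : normedModType R) n k (U : set V) (f : V -> 'rV[R]_n) i :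
  open U -> Ck k U f -> Ck k U (fun x => f x 0 i).
Proof.
move=> oU; elim: k f => [|k IH] f.
  move=> cf x Ux; apply: (@continuous_comp _ _ _ f (fun M : 'rV[R]_n => M 0 i)).
    exact: cf.
  exact: coord_continuous.
move=> [df Df]; split=> [x Ux|v].
  apply: (@differentiable_comp _ _ _ _ f (fun M : 'rV[R]_n => M 0 i)).
    exact: df.
  exact: differentiable_coord.
apply: (@Ck_eq _ _ _ _ _ (fun x => ('D_v f x) 0 i)) => //; last exact/IH/Df.
by move=> x Ux; rewrite derive_rV//; apply/diff_derivable/df.
Qed.

Lemma Ck_rV (V : normedModType R) n k (U : set V) (f : V -> 'rV[R]_n) :
  open U -> (forall i, Ck k U (fun x => f x 0 i)) -> Ck k U f.
Proof.
move=> oU; elim: k f => [|k IH] f fi.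
  by move=> x Ux; apply: continuous_rV => i; exact: fi.
have df x : U x -> differentiable f x.
  by move=> Ux; apply: differentiable_rV => i; have [+ _] := fi i; apply.
split=> [x /df//|v]; apply: IH => i; have [_ Dfi] := fi i.
apply: (@Ck_eq _ _ _ _ _ ('D_v (fun x => f x 0 i))) => //.
  by move=> x Ux; rewrite derive_rV//; apply/diff_derivable/df.
exact: Dfi.
Qed.

Lemma Ck_sum (V : normedModType R) n k (U : set V) (f : 'I_n -> V -> R) :
  open U -> (forall i, Ck k U (f i)) -> Ck k U (fun x => \sum_(i < n) f i x).
Proof.
move=> oU fk; elim: n f fk => [|n IH] f fk.
  apply: (@Ck_eq _ _ _ _ _ (fun=> 0)) => //; last exact: Ck_cst.
  by move=> x _; rewrite big_ord0.
apply: (@Ck_eq _ _ _ _ _ (fun x => f ord0 x + \sum_(i < n) f (lift ord0 i) x)) => //.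
  by move=> x _; rewrite big_ord_recl.
by apply: CkD => //; apply: IH.
Qed.

Lemma pairZ_sum n (s : R) (p : 'rV[R]_n) :
  (s, p) = s *: (1, 0) + \sum_(i < n) p 0 i *: (0, delta_mx 0 i) :> R * 'rV[R]_n.
Proof.
have -> : \sum_(i < n) p 0 i *: ((0, delta_mx 0 i) : R * 'rV[R]_n) = (0, p).
  rewrite [in RHS](row_sum p).
  elim/big_rec2 : _ => // i y1 y2 _ ->.
  by apply/pair_equal_spec => /=; split=> //; rewrite ?scaler0 ?addr0.
by apply/pair_equal_spec => /=; split; rewrite ?scaler0 ?addr0 ?add0r//; exact/esym/mulr1.
Qed.

Lemma derive_comp_pair (V : normedModType R) n (G : R * 'rV[R]_n -> R)
    (s : V -> R) (p : V -> 'rV[R]_n) (x v : V) :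
  differentiable G (s x, p x) -> differentiable s x -> differentiable p x ->
  'D_v (fun y => G (s y, p y)) x = 'd G (s x, p x) ('D_v s x, 'D_v p x).
Proof.
move=> dG ds dp; have dsp := differentiable_pair ds dp.
rewrite (deriveE _ ds) (deriveE _ dp).
have dc : differentiable (G \o (fun y => (s y, p y))) x by exact: differentiable_comp.
rewrite -[LHS]/('D_v (G \o (fun y => (s y, p y))) x) (deriveE _ dc).
by rewrite diff_comp//= diff_pair.
Qed.

(** The chain rule differentiates [G] in a direction that varies with [x], whereas the induction
    hypothesis speaks of fixed directions. Expanding the direction in a basis turns the derivative
    into a finite sum of products, each factor of which is covered. *)
Lemma Ck_comp_pair (V : normedModType R) n k (U : set V) (W : set (R * 'rV[R]_n))
    (G : R * 'rV[R]_n -> R) (s : V -> R) (p : V -> 'rV[R]_n) : open U ->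
  (forall x, U x -> W (s x, p x)) -> Ck k W G -> Ck k U s -> Ck k U p ->
  Ck k U (fun x => G (s x, p x)).
Proof.
move=> oU UW; elim: k G => [|k IH] G.
  move=> GW sU pU x Ux.
  apply: (@continuous_comp _ _ _ (fun x => (s x, p x)) G); last exact/GW/UW.
  exact: (cvg_pair (sU x Ux) (pU x Ux)).
move=> GW sU pU; have [[dG DG] [[ds Ds] [dp Dp]]] := (GW, (sU, pU)).
have dsp x : U x -> differentiable (fun x => (s x, p x)) x.
  by move=> Ux; apply: differentiable_pair; [exact: ds|exact: dp].
split=> [x Ux|v].
  by apply: (@differentiable_comp _ _ _ _ (fun x => (s x, p x)) G);
    [exact: dsp|exact/dG/UW].
apply: (@Ck_eq _ _ _ _ _ (fun x => 'D_v s x * 'D_(1, 0) G (s x, p x) +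
    \sum_(i < n) 'D_v p x 0 i * 'D_(0, delta_mx 0 i) G (s x, p x))) => //.
  move=> x Ux; rewrite derive_comp_pair; [|exact/dG/UW|exact: ds|exact: dp].
  have dGx := dG _ (UW _ Ux).
  rewrite (pairZ_sum ('D_v s x) ('D_v p x)) linearD linearZ linear_sum; congr (_ + _).
    by rewrite (deriveE _ dGx).
  by apply: eq_bigr => i _; rewrite linearZ (deriveE _ dGx).
apply: CkD => //.
  apply: CkM; [by []|exact: Ds|apply: (IH ('D_(1, 0) G)); [exact: DG|exact: CkW|exact: CkW]].
apply: Ck_sum => // i; apply: CkM; [by []|apply: Ck_coord => //; exact: Dp|].
by apply: (IH ('D_(0, delta_mx 0 i) G)); [exact: DG|exact: CkW|exact: CkW].
Qed.

Lemma derive_slice n (K : R -> 'rV[R]_n -> R) s p v :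
  'D_(0, v) (fun z : R * 'rV[R]_n => K z.1 z.2) (s, p) = 'D_v (K s) p.
Proof.
pose K' (z : R * 'rV[R]_n) := K z.1 z.2.
have e (h : R) : h^-1 *: ((K' \o shift (s, p)) (h *: (0, v)) - K' (s, p)) =
    h^-1 *: ((K s \o shift p) (h *: v) - K s p).
  by rewrite /K'/= scaler0 add0r.
by rewrite /derive; under eq_fun do rewrite e.
Qed.

End Rows.

(** * Differentiation rules for functions given by pointwise formulas *)

Section Derivatives.
Context {R : realType}.

Lemma is_derive_add (V : normedModType R) (f g : V -> R) x v a b :
  is_derive x v f a -> is_derive x v g b ->
  is_derive x v (fun y => f y + g y) (a + b).
Proof. by move=> df dg; exact: is_deriveD. Qed.

Lemma is_derive_opp (V : normedModType R) (f : V -> R) x v a :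
  is_derive x v f a -> is_derive x v (fun y => - f y) (- a).
Proof. by move=> df; exact: is_deriveN. Qed.

Lemma is_derive_sub (V : normedModType R) (f g : V -> R) x v a b :
  is_derive x v f a -> is_derive x v g b ->
  is_derive x v (fun y => f y - g y) (a - b).
Proof. by move=> df dg; exact: is_deriveB. Qed.

Lemma is_derive_mul (V : normedModType R) (f g : V -> R) x v a b :
  is_derive x v f a -> is_derive x v g b ->
  is_derive x v (fun y => f y * g y) (f x * b + g x * a).
Proof. by move=> df dg; exact: is_deriveM. Qed.

Lemma is_derive_exp (V : normedModType R) (f : V -> R) n x v a :
  is_derive x v f a ->
  is_derive x v (fun y => f y ^+ n) (n%:R * f x ^+ n.-1 * a).
Proof.
move=> df; rewrite (_ : (fun y => f y ^+ n) = f ^+ n); last by rewrite exprfctE.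
exact: is_deriveX.
Qed.

Lemma is_derive_inv (V : normedModType R) (f : V -> R) x v a : f x != 0 ->
  is_derive x v f a -> is_derive x v (fun y => (f y)^-1) (- a / f x ^+ 2).
Proof.
move=> fx0 [df <-]; split; first exact: derivableV.
by rewrite deriveV// scaleNr mulNr mulrC.
Qed.

Lemma is_derive_chain (V : normedModType R) (g : R -> V) (f : R -> R) x a (b : V) :
  is_derive (f x) 1 g b -> is_derive x 1 f a ->
  is_derive x 1 (fun y => g (f y)) (a *: b).
Proof.
move=> [/derivable1_diffP dg <-] [/derivable1_diffP df <-].
have dgf : differentiable (g \o f) x by exact: differentiable_comp.
split; first exact/derivable1_diffP.
rewrite -[LHS]/('D_1 (g \o f) x) (deriveE _ dgf) (diff_comp df dg)/=.
rewrite -(deriveE _ df) -(derive_scal1 ('D_1 f x)); last exact/derivable1_diffP.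
by rewrite (deriveE _ dg).
Qed.

Lemma is_derive_uniq (V W : normedModType R) (f : V -> W) x v a b :
  is_derive x v f a -> is_derive x v f b -> a = b.
Proof. by move=> [_ <-] [_ <-]. Qed.

Lemma is_derive_along (V W : normedModType R) (G : V -> W) (c : R -> V) t w :
  differentiable G (c t) -> is_derive t 1 c w ->
  is_derive t 1 (fun u => G (c u)) ('D_w G (c t)).
Proof.
move=> dG [/derivable1_diffP dc <-].
have dGc : differentiable (G \o c) t by exact: differentiable_comp.
split; first exact/derivable1_diffP.
rewrite -[LHS]/('D_1 (G \o c) t) (deriveE _ dGc) (diff_comp dc dG)/=.
by rewrite (deriveE _ dG) (deriveE _ dc).
Qed.

End Derivatives.

(** * Smoothness of f(x) / x *)

Section Hadamard.
Context {R : realType} (d : R) (d0 : 0 < d).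
Let I : set R := [set x | `|x| < d].

Let oI : open I.
Proof.
rewrite (_ : I = ball 0 d); first exact: ball_open.
by apply/seteqP; split => x; rewrite -ball_normE/= /I/= sub0r normrN.
Qed.

Let I0 : I 0. Proof. by rewrite /I/= normr0. Qed.

Let memI (x : R) : x \in `]-d, d[ -> I x.
Proof. by rewrite in_itv/= /I/= ltr_norml. Qed.

Let I00 : (0 : R) \in `]- d, d[. Proof. by rewrite in_itv/= oppr_lt0 d0. Qed.

Let near_neq0 (x : R) : x != 0 -> \forall z \near x, z != 0.
Proof. by move=> x0; apply: open_nbhs_nbhs; split=> //; exact: open_neq. Qed.

(* l'Hopital's rule, since [x^(n+1) y] has derivative [x^n F]. *)
Let euler_cvg n (F y : R -> R) :
  {for (0 : R), continuous F} ->
  (forall x : R, I x -> x != 0 ->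
     is_derive x (1 : R) y ((F x - n.+1%:R * y x) / x)) ->
  (fun x => x ^+ n.+1 * y x) x @[x --> (0 : R)] --> (0 : R) ->
  y x @[x --> (0 : R)^'] --> F 0 / n.+1%:R.
Proof.
move=> cF dy y0.
(* Away from 0 these are the derivatives of [x^(n+1) y] and [x^(n+1)]; the values at 0 are chosen so
   that the quotient is [F x / n.+1%:R] everywhere. *)
pose df (x : R) : R := if x == 0 then F 0 else x ^+ n * F x.
pose dg (x : R) : R := if x == 0 then n.+1%:R else n.+1%:R * x ^+ n.
have dfg x : df x / dg x = F x / n.+1%:R.
  rewrite /df /dg; case: eqP => [->//|/eqP x0].
  by rewrite [n.+1%:R * _]mulrC -mulf_div divff ?mul1r// expf_neq0.
have : (fun x => x ^+ n.+1 * y x / x ^+ n.+1) x @[x --> (0 : R)^'] --> F 0 / n.+1%:R.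
  apply: (@lhopital R (fun x => x ^+ n.+1 * y x) df (fun x => x ^+ n.+1) dg
    (- d) d 0 (F 0 / n.+1%:R)) => //.
  - move=> x /set_mem[/= /memI Ix /eqP x0].
    rewrite /df (negbTE x0).
    have dX := is_derive_exp n.+1 (is_derive_id x (1 : R)).
    apply: (is_derive_eq (is_derive_mul dX (dy _ Ix x0))) => /=.
    by rewrite exprS; field.
  - move=> x /set_mem[/= /memI Ix /eqP x0].
    rewrite /dg (negbTE x0).
    by apply: (is_derive_eq (is_derive_exp n.+1 (is_derive_id _ _))) => /=; rewrite mulr1.
  - by have := @exprn_continuous R n.+1 0; rewrite /continuous_at expr0n.
  - move=> x /set_mem[_ /eqP x0]; rewrite /dg (negbTE x0).
    by rewrite mulf_neq0 ?pnatr_eq0// expf_neq0.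
  - under eq_fun do rewrite dfg.
    by apply: cvgM; [exact: cF|exact: cvg_cst].
apply: cvg_trans; apply: near_eq_cvg; near=> x.
have x0 : x != 0 by near: x; exact: nbhs_dnbhs_neq.
by rewrite mulrAC divff ?mul1r// expf_neq0.
Unshelve. all: by end_near. Qed.

(* The equation [x y' + (n + 1) y = F] implies the same equation for [y'] with
   [n + 1] and [F'] in place of [n] and [F]. *)
Let euler_Ck k n (F y : R -> R) :
  (forall j, Ck j I F) ->
  (forall x : R, I x -> x != 0 ->
     is_derive x (1 : R) y ((F x - n.+1%:R * y x) / x)) ->
  (fun x => x ^+ n.+1 * y x) x @[x --> (0 : R)] --> (0 : R) ->
  y 0 = F 0 / n.+1%:R -> Ck k I y.
Proof.
elim: k n F y => [|k IH] n F y FI dy y0 y00.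
  move=> x Ix; have [->|x0] := eqVneq x 0.
    by apply/continuous_withinNx; rewrite y00; exact: euler_cvg (FI 0%N _ I0) dy y0.
  apply/differentiable_continuous/derivable1_diffP.
  by have [] := dy _ Ix x0.
have cy : {for (0 : R), continuous y}.
  by apply/continuous_withinNx; rewrite y00; exact: euler_cvg (FI 0%N _ I0) dy y0.
pose F1 := 'D_1 F.
have dF x : I x -> is_derive x (1 : R) F (F1 x).
  by move=> Ix; split=> //; apply/derivable1_diffP; have [+ _] := FI 1%N; exact.
have F1I j : Ck j I F1 by have [_ +] := FI j.+1; exact.
(* The candidate for [y']: away from 0 it is read off the equation, and at 0 it is the value
   [F'(0) / (n + 2)] forced by the differentiated equation. *)
pose y1 (x : R) : R := if x == 0 then F1 0 / n.+2%:R else (F x - n.+1%:R * y x) / x.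
have dy1 x : I x -> x != 0 ->
    is_derive x (1 : R) y1 ((F1 x - n.+2%:R * y1 x) / x).
  move=> Ix x0.
  have near_y1 : \near x, (F x - n.+1%:R * y x) / x = y1 x.
    near=> z; rewrite /y1.
    have /negbTE -> // : z != 0 by near: z; exact: near_neq0.
  apply: (near_eq_is_derive near_y1).
  have dny := is_derive_mul (is_derive_cst (n.+1%:R : R) x 1) (dy _ Ix x0).
  have dnum := is_derive_sub (dF _ Ix) dny.
  apply: (is_derive_eq (is_derive_mul dnum (is_derive_inv x0 (is_derive_id _ _)))).
  by rewrite /y1 (negbTE x0) /cst /= -!natr1; field.
have y10 : (fun x => x ^+ n.+2 * y1 x) x @[x --> (0 : R)] --> (0 : R).
  apply: (@cvg_trans _ ((fun x => x ^+ n.+1 * (F x - n.+1%:R * y x)) x @[x --> (0 : R)])).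
    apply: near_eq_cvg; near=> x; rewrite /y1; case: eqP => [->|/eqP x0].
      by rewrite !expr0n !mul0r.
    by rewrite [in RHS]exprSr; field.
  have : (fun x => x ^+ n.+1 * (F x - n.+1%:R * y x)) x @[x --> (0 : R)] -->
      (0 : R) ^+ n.+1 * (F 0 - n.+1%:R * y 0).
    apply: cvgM; first exact: exprn_continuous.
    by apply: cvgB; [exact: (FI 0%N _ I0)|apply: cvgM; [exact: cvg_cst|exact: cy]].
  by rewrite expr0n mul0r.
have y100 : y1 0 = F1 0 / n.+2%:R by rewrite /y1 eqxx.
have y1I := IH n.+1 F1 y1 F1I dy1 y10 y100.
apply: (@Ck_derive1 _ _ _ _ y1) => // x Ix.
have [->|x0] := eqVneq x 0; last by rewrite /y1 (negbTE x0); exact: dy.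
(* At 0 the difference quotient is again treated by l'Hopital's rule, since [y1] is continuous
   there. *)
have : (fun x => (y x - y 0) / x) x @[x --> (0 : R)^'] --> y1 0.
  have cy1 : y1 x @[x --> (0 : R)^'] --> y1 0.
    by rewrite y100; exact: euler_cvg (F1I 0%N _ I0) dy1 y10.
  apply: (@lhopital R (fun x => y x - y 0) y1 id (cst 1) (- d) d 0 (y1 0)) => //.
  - move=> z /set_mem[/= /memI Iz /eqP z0].
    apply: (is_derive_eq (is_derive_sub (dy _ Iz z0) (is_derive_cst (y 0) z 1))).
    by rewrite subr0 /y1 (negbTE z0).
  - have : (fun x => y x - y 0) x @[x --> (0 : R)] --> y 0 - y 0.
      by apply: cvgB; [exact: cy|exact: cvg_cst].
    by rewrite subrr.
  - by move=> z _; exact: oner_neq0.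
  - under eq_fun do rewrite divr1.
    exact/continuous_withinNx.
move=> cyq.
have H : (fun h : R => h^-1 *: ((y \o shift 0) (h *: (1 : R)) - y 0)) @ 0^' --> y1 0.
  apply: cvg_trans cyq; apply: near_eq_cvg; near=> h.
  by rewrite /= addr0 [h *: 1]mulr1 mulrC.
split; last exact/cvg_lim.
by apply/cvg_ex; exists (y1 0).
Unshelve. all: by end_near. Qed.

(** The quotient [y = f / x] solves [x y' + y = f'], the case [n = 0], [F = f'] of the equation
    above. This replaces differentiation under the integral of [f'(t x)] over [t]. *)
Lemma hadamard_quotient (f : R -> R) : smooth I f -> f 0 = 0 ->
  smooth I (fun x => if x == 0 then 'D_1 f 0 else f x / x).
Proof.
move=> fI f0 k.
set y := (fun x => _).
have df (x : R) : I x -> is_derive x (1 : R) f ('D_1 f x).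
  by move=> Ix; split=> //; apply/derivable1_diffP; have [+ _] := fI 1%N; exact.
apply: (@euler_Ck k 0 ('D_1 f) y).
- by move=> j; have [_ +] := fI j.+1; exact.
- move=> x Ix x0.
  have near_y : \near x, f x / x = y x.
    near=> z; rewrite /y.
    have /negbTE -> // : z != 0 by near: z; exact: near_neq0.
  apply: (near_eq_is_derive near_y).
  apply: (is_derive_eq (is_derive_mul (df _ Ix) (is_derive_inv x0 (is_derive_id _ _)))).
  by rewrite /y (negbTE x0); field.
- have : f x @[x --> (0 : R)] --> (0 : R) by rewrite -{2}f0; exact: (fI 0%N _ I0).
  apply: cvg_trans; apply: near_eq_cvg; near=> x.
  rewrite /y expr1; case: eqP => [->|/eqP x0]; first by rewrite mul0r f0.
  by field.
- by rewrite /y eqxx divr1.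
Unshelve. all: by end_near. Qed.

End Hadamard.

(** * Angles and time changes *)

Section Angles.
Context {R : realType}.

Lemma angle_exists (x y : R) : x ^+ 2 + y ^+ 2 = 1 ->
  exists s, [/\ 0 <= s, s < 2 * pi, x = cos s & y = sin s].
Proof.
move=> xy1.
have xle : -1 <= x <= 1 by rewrite -ler_norml -sqrtr_sqr -sqrtr1 ler_wsqrtr//; nra.
have pi0 := pi_gt0 R.
have c0 := acos_ge0 xle; have cp := acos_lepi xle.
have xc : x = cos (acos x) by rewrite acosK// in_itv.
have sy : sin (acos x) = `|y|.
  by rewrite sin_acos// (_ : 1 - x ^+ 2 = y ^+ 2) ?sqrtr_sqr//; lra.
have [y0|y0] := leP 0 y.
  by exists (acos x); split=> //; [lra|rewrite sy ger0_norm].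
exists (2 * pi - acos x); split.
- lra.
- rewrite ltrBlDr ltrDl lt_neqAle c0 andbT eq_sym; apply/eqP => a0.
  by move: sy; rewrite a0 sin0 ltr0_norm//; lra.
- by rewrite mulr_natl addrC cosD2pi cosN.
- by rewrite mulr_natl addrC sinD2pi sinN sy ltr0_norm// opprK.
Qed.

Lemma cos_eq1_lt2pi (s : R) : 0 <= s -> s < 2 * pi -> cos s = 1 -> s = 0.
Proof.
move=> s0 s2 cs; have pi0 := pi_gt0 R.
have [sp|sp] := leP s pi.
  by apply: cos_inj; rewrite ?in_itv/= ?cos0//; lra.
have : 2 * pi - s = 0.
  apply: cos_inj; [rewrite in_itv/=; lra|rewrite in_itv/=; lra|].
  by rewrite mulr_natl addrC cosD2pi cosN cos0.
by lra.
Qed.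

Lemma periodic_int (T : Type) (f : R -> T) (p : R) (n : int) s :
  (forall s, f (s + p) = f s) -> f (s + n%:~R * p) = f s.
Proof.
move=> fp.
have fn (k : nat) t : f (t + k%:R * p) = f t.
  elim: k t => [|k IH] t; first by rewrite mul0r addr0.
  by rewrite -natr1 mulrDl mul1r addrA fp IH.
case: n => k; first by rewrite -pmulrn; exact: fn.
by rewrite NegzE mulrNz mulNr -[in RHS](subrK (k.+1%:R * p) s) fn.
Qed.

Lemma mod2pi (s : R) : exists (n : int), 0 <= s - n%:~R * (2 * pi) < 2 * pi.
Proof.
have pi0 := pi_gt0 R; have pi2 : 0 < 2 * pi :> R by lra.
exists (Num.floor (s / (2 * pi))).
have := Num.Theory.floor_le (s / (2 * pi)).
have := Num.Theory.floorD1_gt (s / (2 * pi)).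
rewrite ltr_pdivrMr// ler_pdivlMr// intrD mulrDl mul1r => h1 h2.
by apply/andP; split; lra.
Qed.

(** This is what makes quantities written in the coordinate [s] well defined on the sphere,
    whichever branch of the angle is used. *)
Lemma periodic_angle (T : Type) (f : R -> T) s t :
  (forall s, f (s + 2 * pi) = f s) -> cos s = cos t -> sin s = sin t -> f s = f t.
Proof.
move=> fp cst sst.
have [n /andP[n0 n2]] := mod2pi (s - t).
have cos2pi (u : R) : cos (u + 2 * pi) = cos u by rewrite mulr_natl cosD2pi.
have : s - t - n%:~R * (2 * pi) = 0.
  apply: cos_eq1_lt2pi => //.
  rewrite -mulNr -mulrNz periodic_int// cosB cst sst.
  by rewrite -!expr2 cos2Dsin2.
move=> e; have -> : s = t + n%:~R * (2 * pi) by lra.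
exact: periodic_int.
Qed.

End Angles.

Section TimeChange.
Context {R : realType}.

(** An integral with lower limit [a] is an antiderivative only to the right of [a]. The lower limit
    [- |x| - 1] lies to the left of both [x] and 0, and subtracting the value at 0 removes the
    dependence on the lower limit. *)
Lemma antiderivative (m : R -> R) : continuous m ->
  exists T : R -> R, forall x, is_derive x (1 : R) T (m x).
Proof.
move=> cm.
pose F (a x : R) : R := (\int[lebesgue_measure]_(t in [set` `[a, x]]) m t)%R.
have dF (a x : R) : a < x -> is_derive x 1 (F a) (m x).
  move=> ax.
  have [||dFx Fx] := @continuous_FTC1_closed R m a x (x + 1) _ _ ax (cm x).
  - by rewrite ltrDl.
  - apply: continuous_compact_integrable; first exact: segment_compact.
    exact: continuous_subspaceT.
  - by split; [exact: dFx|rewrite -derive1E; exact: Fx].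
have Fconst (a b x y : R) : a < x -> b < x -> x <= y -> F a x - F b x = F a y - F b y.
  move=> ax bx xy.
  have dFG (z : R) : x <= z -> is_derive z 1 (fun z => F a z - F b z) 0.
    move=> xz; have [az bz] := (lt_le_trans ax xz, lt_le_trans bx xz).
    by apply: (is_derive_eq (is_derive_sub (dF _ _ az) (dF _ _ bz))); rewrite subrr.
  have [||c _] := @MVT_segment R (fun z => F a z - F b z) (fun=> 0) x y xy.
  - by move=> z; rewrite in_itv/= => /andP[/ltW/dFG].
  - apply: derivable_within_continuous => z; rewrite in_itv/= => /andP[/dFG xz _].
    exact: ex_derive.
  by rewrite mul0r => /eqP; rewrite subr_eq0 => /eqP.
have Fc (a b x : R) : a < x -> b < x -> a < 0 -> b < 0 -> F a x - F a 0 = F b x - F b 0.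
  move=> ax bx a0 b0.
  have [x0|/ltW x0] := leP 0 x.
    by have := Fconst _ _ _ _ a0 b0 x0; lra.
  by have := Fconst _ _ _ _ ax bx x0; lra.
pose T (x : R) := F (- `|x| - 1) x - F (- `|x| - 1) 0.
have xN (x : R) : - `|x| - 1 < x by have := lerNnormlW (lexx `|x|); lra.
exists T => x.
pose a := - `|x| - 2.
have ax : a < x by have := xN x; rewrite /a; lra.
have a0 : a < 0 by rewrite /a; have := normr_ge0 x; lra.
have : \near x, F a x - F a 0 = T x.
  near=> z.
  have az : a < z by near: z; exact: lt_nbhsr.
  have zN : - `|z| - 1 < 0 by have := normr_ge0 z; lra.
  exact: Fc.
move=> /near_eq_is_derive; apply.
by apply: (is_derive_eq (is_derive_sub (dF _ _ ax) (is_derive_cst _ _ _))); rewrite subr0.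
Unshelve. all: by end_near. Qed.

(** The solution of [sg' = 1 / m(sg)] is the inverse of the antiderivative of [m] that vanishes at
    [s0]. The lower bound [m0] makes that antiderivative strictly increasing and onto, so the
    solution exists for all time and reaches every value. *)
Lemma time_change (m : R -> R) (m0 s0 : R) : continuous m -> 0 < m0 ->
  (forall s, m0 <= m s) ->
  exists sg : R -> R, [/\ sg 0 = s0,
    forall t, is_derive t (1 : R) sg (m (sg t))^-1,
    forall s, exists t, sg t = s & {mono sg : t u / t < u}].
Proof.
move=> cm m00 mm0; have [T0 dT0] := antiderivative cm.
pose T x := T0 x - T0 s0.
have dT (x : R) : is_derive x 1 T (m x).
  by apply: (is_derive_eq (is_derive_sub (dT0 x) (is_derive_cst _ _ _))); rewrite subr0.
have Tcont : continuous T.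
  move=> x; apply/differentiable_continuous/derivable1_diffP; exact: ex_derive.
have Tgrow (x y : R) : x <= y -> m0 * (y - x) <= T y - T x.
  move=> xy.
  have [c _ ->] := MVT_segment xy (fun z _ => dT z) (continuous_subspaceT Tcont).
  by rewrite ler_wpM2r// subr_ge0.
have Tmono : {mono T : x y / x < y}.
  apply: leW_mono; apply: le_mono => x y xy.
  have := Tgrow _ _ (ltW xy).
  have : 0 < m0 * (y - x) by rewrite mulr_gt0// subr_gt0.
  lra.
have Tsurj t : exists s, T s = t.
  (* Growth at rate at least [m0] carries [T] past [|t|] within distance [b] of [s0], on either
     side. *)
  pose b := `|t| / m0.
  have Ts0 : T s0 = 0 by rewrite /T subrr.
  have b0 : 0 <= b by rewrite divr_ge0// ltW.
  have mb : m0 * b = `|t| by rewrite /b; field; lra.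
  have h1 : `|t| <= T (s0 + b).
    have /Tgrow : s0 <= s0 + b by lra.
    by rewrite Ts0 (_ : s0 + b - s0 = b) ?mb ?subr0//; lra.
  have h2 : T (s0 - b) <= - `|t|.
    have /Tgrow : s0 - b <= s0 by lra.
    by rewrite Ts0 (_ : s0 - (s0 - b) = b) ?mb ?sub0r; lra.
  have bb : s0 - b <= s0 + b by lra.
  have tb : Num.min (T (s0 - b)) (T (s0 + b)) <= t <= Num.max (T (s0 - b)) (T (s0 + b)).
    have := lerNnormlW (lexx `|t|); have := ler_norm t.
    by move=> ht hN; rewrite ge_min le_max; apply/andP; split; apply/orP; [left|right]; lra.
  have [c _ Tc] := IVT bb (continuous_subspaceT Tcont) tb.
  by exists c.
have /choice[sg sgK] := Tsurj.
have Tinj : injective T.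
  move=> x y Txy; case: (ltgtP x y) => // xy; have := Tmono x y; have := Tmono y x;
  by rewrite xy Txy !ltxx.
have TK : cancel T sg by move=> x; apply: Tinj; rewrite sgK.
exists sg; split.
- by apply: Tinj; rewrite sgK /T subrr.
- move=> t; have := @is_derive_inverse R T sg (m (sg t)) (sg t).
  rewrite sgK; apply.
  + by near=> z; exact: TK.
  + by near=> z; exact: Tcont.
  + by rewrite gt_eqF// (lt_le_trans m00).
- by move=> s; exists (T s).
- by move=> t u; rewrite -Tmono !sgK.
Unshelve. all: by end_near.
Qed.

End TimeChange.

(** * The open solid torus in the 3-sphere *)

Section Vectors.
Context {R : realType}.

Definition rv2 (a b : R) : 'rV[R]_2 := \row_j [:: a; b]`_j.
Definition rv4 (a b c d : R) : 'rV[R]_4 := \row_j [:: a; b; c; d]`_j.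

Lemma rv20 a b : rv2 a b 0 0 = a. Proof. by rewrite mxE. Qed.
Lemma rv21 a b : rv2 a b 0 1 = b. Proof. by rewrite mxE. Qed.
Lemma rv40 a b c d : rv4 a b c d 0 0 = a. Proof. by rewrite mxE. Qed.
Lemma rv41 a b c d : rv4 a b c d 0 1 = b. Proof. by rewrite mxE. Qed.
Lemma rv42 a b c d : rv4 a b c d 0 2 = c. Proof. by rewrite mxE. Qed.
Lemma rv43 a b c d : rv4 a b c d 0 3 = d. Proof. by rewrite mxE. Qed.

Definition rvE := (rv20, rv21, rv40, rv41, rv42, rv43).

Lemma ord2P (P : 'I_2 -> Prop) : P 0 -> P 1 -> forall i, P i.
Proof.
move=> P0 P1 [[|[|//]] i].
  by rewrite (_ : Ordinal i = 0)//; exact/val_inj.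
by rewrite (_ : Ordinal i = 1)//; exact/val_inj.
Qed.

Lemma ord4P (P : 'I_4 -> Prop) : P 0 -> P 1 -> P 2 -> P 3 -> forall i, P i.
Proof.
move=> P0 P1 P2 P3 [[|[|[|[|//]]]] i].
- by rewrite (_ : Ordinal i = 0)//; exact/val_inj.
- by rewrite (_ : Ordinal i = 1)//; exact/val_inj.
- by rewrite (_ : Ordinal i = 2)//; exact/val_inj.
- by rewrite (_ : Ordinal i = 3)//; exact/val_inj.
Qed.

Lemma eq_rv2 (u v : 'rV[R]_2) : u 0 0 = v 0 0 -> u 0 1 = v 0 1 -> u = v.
Proof. by move=> h0 h1; apply/rowP; exact: ord2P. Qed.

Lemma eq_rv4 (u v : 'rV[R]_4) : u 0 0 = v 0 0 -> u 0 1 = v 0 1 ->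
  u 0 2 = v 0 2 -> u 0 3 = v 0 3 -> u = v.
Proof. by move=> h0 h1 h2 h3; apply/rowP; exact: ord4P. Qed.

Lemma dot2E (u v : 'rV[R]_2) : dot u v = u 0 0 * v 0 0 + u 0 1 * v 0 1.
Proof.
rewrite /dot !big_ord_recl big_ord0 addr0; congr (_ * _ + _ * _);
by congr (_ _ _); exact/val_inj.
Qed.

Lemma dot4E (u v : 'rV[R]_4) :
  dot u v = u 0 0 * v 0 0 + u 0 1 * v 0 1 + u 0 2 * v 0 2 + u 0 3 * v 0 3.
Proof.
rewrite /dot !big_ord_recl big_ord0 addr0 !addrA.
by congr (_ * _ + _ * _ + _ * _ + _ * _); congr (_ _ _); exact/val_inj.
Qed.

Lemma is_derive_rv4 (V : normedModType R) (x v : V) (a b c d : V -> R) a' b' c' d' :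
  is_derive x v a a' -> is_derive x v b b' ->
  is_derive x v c c' -> is_derive x v d d' ->
  is_derive x v (fun y => rv4 (a y) (b y) (c y) (d y)) (rv4 a' b' c' d').
Proof.
move=> da db dc dd; apply: is_derive_rV; apply: ord4P; rewrite rvE;
  by under eq_fun do rewrite rvE.
Qed.

Lemma is_derive_rv2 (V : normedModType R) (x v : V) (a b : V -> R) a' b' :
  is_derive x v a a' -> is_derive x v b b' ->
  is_derive x v (fun y => rv2 (a y) (b y)) (rv2 a' b').
Proof.
move=> da db; apply: is_derive_rV; apply: ord2P; rewrite rvE;
  by under eq_fun do rewrite rvE.
Qed.

Lemma is_derive_entry n (x v : 'rV[R]_n) i :
  is_derive x v (fun y : 'rV[R]_n => y 0 i) (v 0 i).
Proof. exact: (is_derive_coord (is_derive_id x v)). Qed.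

Lemma Ck_id (V : normedModType R) k (U : set V) : Ck k U (fun x : V => x).
Proof. by apply: (@Ck_linear _ _ _ _ _ idfun) => x; exact: cvg_id. Qed.

Lemma Ck_entry n k (U : set 'rV[R]_n) i : open U -> Ck k U (fun y : 'rV[R]_n => y 0 i).
Proof. by move=> oU; apply: Ck_coord => //; exact: Ck_id. Qed.

Lemma Ck_rv4 (V : normedModType R) k (U : set V) (a b c d : V -> R) : open U ->
  Ck k U a -> Ck k U b -> Ck k U c -> Ck k U d ->
  Ck k U (fun y => rv4 (a y) (b y) (c y) (d y)).
Proof.
move=> oU aU bU cU dU; apply: Ck_rV => //; apply: ord4P;
  by under eq_fun do rewrite rvE.
Qed.

Lemma Ck_rv2 (V : normedModType R) k (U : set V) (a b : V -> R) : open U ->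
  Ck k U a -> Ck k U b -> Ck k U (fun y => rv2 (a y) (b y)).
Proof.
move=> oU aU bU; apply: Ck_rV => //; apply: ord2P;
  by under eq_fun do rewrite rvE.
Qed.

Lemma continuous_rv4 (T : topologicalType) (x : T) (a b c d : T -> R) :
  {for x, continuous a} -> {for x, continuous b} ->
  {for x, continuous c} -> {for x, continuous d} ->
  {for x, continuous (fun y => rv4 (a y) (b y) (c y) (d y))}.
Proof.
move=> aU bU cU dU; apply: continuous_rV; apply: ord4P;
  by rewrite /prop_for /continuous_at rvE; under eq_fun do rewrite rvE.
Qed.

Lemma continuous_rv2 (T : topologicalType) (x : T) (a b : T -> R) :
  {for x, continuous a} -> {for x, continuous b} ->
  {for x, continuous (fun y => rv2 (a y) (b y))}.
Proof.
move=> aU bU; apply: continuous_rV; apply: ord2P;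
  by rewrite /prop_for /continuous_at rvE; under eq_fun do rewrite rvE.
Qed.

Lemma Ck_continuous n (U : set 'rV[R]_n) (f : 'rV[R]_n -> R) :
  (forall k, Ck k U f) -> forall x, U x -> {for x, continuous f}.
Proof. by move=> /(_ 0%N). Qed.

Lemma continuous_dot2 : continuous (fun p : 'rV[R]_2 => dot p p).
Proof.
move=> x; apply: (@Ck_continuous 2 setT (fun p => dot p p)) => // k.
have e : (fun p : 'rV[R]_2 => dot p p) = fun p => p 0 0 * p 0 0 + p 0 1 * p 0 1.
  by apply/funext => p; rewrite dot2E.
have o := @openT 'rV[R]_2.
by rewrite e; apply: CkD => //; apply: CkM => //; exact: Ck_entry.
Qed.

Lemma continuous_dot4 : continuous (fun p : 'rV[R]_4 => dot p p).
Proof.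
move=> x; apply: (@Ck_continuous 4 setT (fun p => dot p p)) => // k.
have e : (fun p : 'rV[R]_4 => dot p p) = fun p => p 0 0 * p 0 0 + p 0 1 * p 0 1
    + p 0 2 * p 0 2 + p 0 3 * p 0 3.
  by apply/funext => p; rewrite dot4E.
have o := @openT 'rV[R]_4.
by rewrite e; do ![apply: CkD => //]; apply: CkM => //; exact: Ck_entry.
Qed.

Lemma open_open_disc : open (@open_disc R).
Proof.
have := @open_comp _ _ (fun p : 'rV[R]_2 => dot p p) [set x | x < 1].
by apply; [move=> x _; exact: continuous_dot2|exact: open_lt].
Qed.

End Vectors.

Ltac ckO := solve [assumption | exact: Ck_cst | exact: Ck_entry | exact: Ck_id ].
Ltac ck oU := repeat first [ckO
  | exact oU
  | apply: (CkD oU) | apply: (CkB oU) | apply: (CkN oU) | apply: (CkM oU)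
  | apply: (CkX _ oU) | apply: (CkV oU)].

(** * The modulus and the angle of the second complex coordinate *)

Section Polar.
Context {R : realType}.

Lemma polar_exists (x y : R) : 0 < x ^+ 2 + y ^+ 2 ->
  exists s, [/\ 0 <= s, s < 2 * pi,
    x = Num.sqrt (x ^+ 2 + y ^+ 2) * cos s & y = Num.sqrt (x ^+ 2 + y ^+ 2) * sin s].
Proof.
set r := Num.sqrt _ => r2.
have r0 : r != 0 by rewrite lt0r_neq0// sqrtr_gt0.
have rr : r ^+ 2 = x ^+ 2 + y ^+ 2 by rewrite sqr_sqrtr// ltW.
have [|s [s0 s1 xs ys]] := @angle_exists R (x / r) (y / r).
  by rewrite !expr_div_n -mulrDl -rr divff// expf_neq0.
by exists s; split=> //; [rewrite -xs|rewrite -ys]; field.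
Qed.

Definition rho2 (z : 'rV[R]_4) : R := z 0 2 ^+ 2 + z 0 3 ^+ 2.

Definition nrm2 (z : 'rV[R]_4) : R := z 0 0 ^+ 2 + z 0 1 ^+ 2 + rho2 z.

Lemma nrm2E z : dot z z = nrm2 z.
Proof. by rewrite dot4E /nrm2 /rho2; ring. Qed.

Lemma rho2_ge0 z : 0 <= rho2 z.
Proof. by rewrite /rho2; nra. Qed.

Lemma rho2_eq0 z : rho2 z = 0 -> z 0 2 = 0 /\ z 0 3 = 0.
Proof. by rewrite /rho2 => h; split; nra. Qed.

Lemma Ck_rho2 k U : open U -> Ck k U rho2.
Proof. by move=> oU; rewrite /rho2; ck oU. Qed.

Lemma Ck_nrm2 k U : open U -> Ck k U nrm2.
Proof. by move=> oU; rewrite /nrm2 /rho2; ck oU. Qed.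

(** This branch jumps where [z2] crosses the positive real axis. Smoothness is never claimed for
    [arg] itself, only for [2 pi]-periodic functions of it. *)
Definition arg (z : 'rV[R]_4) : R :=
  xget 0 [set s | [/\ 0 <= s, s < 2 * pi, z 0 2 = Num.sqrt (rho2 z) * cos s
                   & z 0 3 = Num.sqrt (rho2 z) * sin s]].

Lemma argP z : 0 < rho2 z ->
  [/\ 0 <= arg z, arg z < 2 * pi, z 0 2 = Num.sqrt (rho2 z) * cos (arg z)
   & z 0 3 = Num.sqrt (rho2 z) * sin (arg z)].
Proof.
move=> /polar_exists[s sP]; rewrite /arg.
by case: xgetP => [t -> //|/(_ s)]; case.
Qed.

End Polar.

Section SolidTorus.
Context {R : realType}.

Lemma is_derive_comp_pair n (G : R * 'rV[R]_n -> R) (s : R -> R)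
    (p : R -> 'rV[R]_n) (t a : R) (b : 'rV[R]_n) :
  differentiable G (s t, p t) -> is_derive t 1 s a -> is_derive t 1 p b ->
  is_derive t 1 (fun u => G (s u, p u)) ('d G (s t, p t) (a, b)).
Proof.
move=> dG [/derivable1_diffP ds <-] [/derivable1_diffP dp <-].
split; last exact: derive_comp_pair.
apply/derivable1_diffP.
apply: (@differentiable_comp _ _ _ _ (fun u => (s u, p u)) G) => //.
exact: differentiable_pair.
Qed.

Definition rho (w : 'rV[R]_2) : R := Num.sqrt (1 - dot w w).

Definition Psi (s : R) (w : 'rV[R]_2) : 'rV[R]_4 :=
  rv4 (w 0 0) (w 0 1) (rho w * cos s) (rho w * sin s).

(* The differential of [Psi] at [(s, w)] in the direction [(sg, v)]. *)
Definition dPsi (s : R) (w : 'rV[R]_2) (sg : R) (v : 'rV[R]_2) : 'rV[R]_4 :=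
  rv4 (v 0 0) (v 0 1)
    (- (dot w v / rho w) * cos s - rho w * sin s * sg)
    (- (dot w v / rho w) * sin s + rho w * cos s * sg).

Lemma rho_gt0 w : open_disc w -> 0 < rho w.
Proof. by move=> w1; rewrite sqrtr_gt0 subr_gt0. Qed.

Lemma sqr_rho w : disc w -> rho w ^+ 2 = 1 - dot w w.
Proof. by move=> w1; rewrite sqr_sqrtr// subr_ge0. Qed.

Lemma open_discW (w : 'rV[R]_2) : open_disc w -> disc w.
Proof. exact: ltW. Qed.

Lemma rho2_Psi s w : disc w -> rho2 (Psi s w) = 1 - dot w w.
Proof.
move=> w1; rewrite -sqr_rho// /rho2 !rvE !exprMn -mulrDr cos2Dsin2 mulr1//.
Qed.

Lemma nrm2_Psi s w : disc w -> nrm2 (Psi s w) = 1.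
Proof. by move=> w1; rewrite /nrm2 rho2_Psi// !rvE dot2E; ring. Qed.

Lemma dot_Psi s w : disc w -> dot (Psi s w) (Psi s w) = 1.
Proof. by move=> w1; rewrite nrm2E nrm2_Psi. Qed.

Lemma is_derive_dot2 (V : normedModType R) (c : V -> 'rV[R]_2) (t w : V) v :
  is_derive t w c v -> is_derive t w (fun u => dot (c u) (c u)) (2 * dot (c t) v).
Proof.
move=> dc; rewrite (_ : (fun u => _) = fun u => c u 0 0 * c u 0 0 + c u 0 1 * c u 0 1).
  have [d0 d1] := (is_derive_coord dc 0, is_derive_coord dc 1).
  apply: (is_derive_eq (is_derive_add (is_derive_mul d0 d0) (is_derive_mul d1 d1))).
  by rewrite dot2E; ring.
by apply/funext => u; rewrite dot2E.
Qed.

Lemma is_derive_rho (c : R -> 'rV[R]_2) (t : R) v : open_disc (c t) -> is_derive t 1 c v ->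
  is_derive t 1 (fun u => rho (c u)) (- (dot (c t) v / rho (c t))).
Proof.
move=> c1 dc; have c0 : 0 < 1 - dot (c t) (c t) by rewrite subr_gt0.
have d1 := is_derive_sub (is_derive_cst (1 : R) t 1) (is_derive_dot2 dc).
apply: (is_derive_eq (@is_derive_chain _ _ Num.sqrt
  (fun u => 1 - dot (c u) (c u)) _ _ _ (is_derive1_sqrt c0) d1)).
rewrite /rho -[_ *: _]/(_ * _); field.
by rewrite lt0r_neq0// sqrtr_gt0.
Qed.

Lemma is_derive_Psi (th : R -> R) (c : R -> 'rV[R]_2) (t : R) sg v : open_disc (c t) ->
  is_derive t 1 th sg -> is_derive t 1 c v ->
  is_derive t 1 (fun u => Psi (th u) (c u)) (dPsi (th t) (c t) sg v).
Proof.
move=> c1 dth dc; have dr := is_derive_rho c1 dc.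
apply: is_derive_rv4; [exact: is_derive_coord|exact: is_derive_coord| |].
  apply: (is_derive_eq (is_derive_mul dr (is_derive_chain (is_derive_cos _) dth))).
  by rewrite -[_ *: _]/(_ * _); ring.
apply: (is_derive_eq (is_derive_mul dr (is_derive_chain (is_derive_sin _) dth))).
by rewrite -[_ *: _]/(_ * _); ring.
Qed.

Lemma tangent_dPsi s w sg v : open_disc w -> tangent3 (Psi s w) (dPsi s w sg v).
Proof.
move=> w1; rewrite /tangent3/= dot4E !rvE.
have r0 : rho w != 0 by rewrite lt0r_neq0// rho_gt0.
transitivity ((w 0 0 * v 0 0 + w 0 1 * v 0 1) -
  (cos s ^+ 2 + sin s ^+ 2) * dot w v); first by field.
by rewrite cos2Dsin2 mul1r dot2E subrr.
Qed.

(** The disc component of [u] gives [v], and its component along the circle of [s], divided by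
    [rho w], gives [sg]. Tangency to the sphere then determines the remaining radial component as
    [- dot w v / rho w]. *)
Lemma dPsi_surj s w u : open_disc w -> tangent3 (Psi s w) u ->
  exists sg v, u = dPsi s w sg v.
Proof.
move=> w1; rewrite /tangent3/= dot4E !rvE => tu.
have r0 : rho w != 0 by rewrite lt0r_neq0// rho_gt0.
have cs := cos2Dsin2 s.
exists ((cos s * u 0 3 - sin s * u 0 2) / rho w), (rv2 (u 0 0) (u 0 1)).
have -> : dPsi s w ((cos s * u 0 3 - sin s * u 0 2) / rho w) (rv2 (u 0 0) (u 0 1)) =
    rv4 (u 0 0) (u 0 1) ((cos s * u 0 2 + sin s * u 0 3) * cos s -
           sin s * (cos s * u 0 3 - sin s * u 0 2))
        ((cos s * u 0 2 + sin s * u 0 3) * sin s +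
           cos s * (cos s * u 0 3 - sin s * u 0 2)).
  have e : - (dot w (rv2 (u 0 0) (u 0 1)) / rho w) = cos s * u 0 2 + sin s * u 0 3.
    apply: (mulIf r0); rewrite mulNr divfK// dot2E !rvE.
    by move: tu; lra.
  by rewrite /dPsi e !rvE; congr rv4; field.
apply: eq_rv4; rewrite !rvE//.
  by transitivity ((cos s ^+ 2 + sin s ^+ 2) * u 0 2); [rewrite cs mul1r|ring].
by transitivity ((cos s ^+ 2 + sin s ^+ 2) * u 0 3); [rewrite cs mul1r|ring].
Qed.

Lemma Psi_surj z : sphere3 z -> 0 < rho2 z ->
  open_disc (rv2 (z 0 0) (z 0 1)) /\ z = Psi (arg z) (rv2 (z 0 0) (z 0 1)).
Proof.
rewrite /sphere3/= nrm2E => n1 r0.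
have e : 1 - dot (rv2 (z 0 0) (z 0 1)) (rv2 (z 0 0) (z 0 1)) = rho2 z.
  by rewrite -n1 dot2E !rvE /nrm2; ring.
split; first by rewrite /open_disc/= -subr_gt0 e.
have [_ _ z2 z3] := argP r0.
by apply: eq_rv4; rewrite !rvE// /rho e.
Qed.

(** The primitive [r^2 dtheta] of [omega], in Cartesian coordinates. *)
Definition lambda (w v : 'rV[R]_2) : R := w 0 0 * v 0 1 - w 0 1 * v 0 0.

Lemma dot2Zr k (u v : 'rV[R]_2) : dot u (k *: v) = k * dot u v.
Proof. by rewrite !dot2E !mxE; ring. Qed.

Lemma dPsiZ (k s : R) (w : 'rV[R]_2) (sg : R) (v : 'rV[R]_2) :
  k *: dPsi s w sg v = dPsi s w (k * sg) (k *: v).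
Proof. by apply: eq_rv4; rewrite mxE !rvE ?dot2Zr ?mxE//; ring. Qed.

End SolidTorus.

(** * The hemisphere as a surface of section *)

Section Hemisphere.
Context {R : realType}.

Definition hemi (w : 'rV[R]_2) : 'rV[R]_4 := Psi 0 w.

Lemma hemiE w : hemi w = rv4 (w 0 0) (w 0 1) (rho w) 0.
Proof. by rewrite /hemi /Psi cos0 sin0 mulr1 mulr0. Qed.

Let S := hemi @` disc.
Let B := hemi @` circle.

Lemma hemisphereP z : S z <-> [/\ sphere3 z, 0 <= z 0 2 & z 0 3 = 0].
Proof.
split=> [[w w1 <-]|[z1 z2 z3]].
  by split; [exact: dot_Psi|rewrite hemiE rvE sqrtr_ge0|rewrite hemiE rvE].
have e : 1 - dot (rv2 (z 0 0) (z 0 1)) (rv2 (z 0 0) (z 0 1)) = z 0 2 ^+ 2.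
  by move: z1; rewrite /sphere3/= dot4E dot2E !rvE z3 => <-; ring.
exists (rv2 (z 0 0) (z 0 1)).
  by rewrite /disc/= -subr_ge0 e sqr_ge0.
by rewrite hemiE /rho e; apply: eq_rv4; rewrite !rvE// sqrtr_sqr ger0_norm.
Qed.

Lemma equatorP z : B z <-> [/\ sphere3 z, z 0 2 = 0 & z 0 3 = 0].
Proof.
split=> [[w w1 <-]|[z1 z2 z3]].
  rewrite /circle/= in w1.
  split; first by apply: dot_Psi; rewrite /disc/= w1.
    by rewrite hemiE rvE /rho w1 subrr sqrtr0.
  by rewrite hemiE rvE.
have e : 1 - dot (rv2 (z 0 0) (z 0 1)) (rv2 (z 0 0) (z 0 1)) = 0.
  by move: z1; rewrite /sphere3/= dot4E dot2E !rvE z2 z3 => <-; ring.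
exists (rv2 (z 0 0) (z 0 1)); first by rewrite /circle/=; lra.
by rewrite hemiE /rho e sqrtr0; apply: eq_rv4; rewrite !rvE.
Qed.

Lemma hemisphere_interiorP z : (S `\` B) z <-> [/\ sphere3 z, 0 < z 0 2 & z 0 3 = 0].
Proof.
split=> [[/hemisphereP[z1 z2 z3] nB]|[z1 z2 z3]].
  split=> //; rewrite lt_neqAle z2 andbT eq_sym; apply/eqP => z20.
  by apply: nB; apply/equatorP.
split; first by apply/hemisphereP; split=> //; exact: ltW.
by move=> /equatorP[_ z20 _]; rewrite z20 ltxx in z2.
Qed.

Lemma continuous_rho : continuous (@rho R).
Proof.
move=> w; apply: (@continuous_comp _ _ _ (fun w : 'rV[R]_2 => 1 - dot w w)).
  apply: continuousB; [exact: cst_continuous|exact: continuous_dot2].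
exact: sqrt_continuous.
Qed.

Lemma continuous_hemi : continuous hemi.
Proof.
move=> w; rewrite (_ : hemi = fun w => rv4 (w 0 0) (w 0 1) (rho w) 0); last first.
  by apply/funext => ?; rewrite hemiE.
apply: continuous_rv4; [exact: coord_continuous|exact: coord_continuous|
  exact: continuous_rho|exact: cst_continuous].
Qed.

Lemma smooth_hemi : smooth (@open_disc R) hemi.
Proof.
move=> k; have oU := @open_open_disc R.
rewrite (_ : hemi = fun w => rv4 (w 0 0) (w 0 1) (rho w) 0); last first.
  by apply/funext => ?; rewrite hemiE.
apply: Ck_rv4 => //; try ck oU.
rewrite (_ : rho = fun w => Num.sqrt (1 - (w 0 0 * w 0 0 + w 0 1 * w 0 1))); last first.
  by apply/funext => w; rewrite /rho dot2E.
apply: (Ck_comp1 oU _ (smooth_sqrt k)); last by ck oU.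
by move=> w; rewrite /open_disc/= dot2E; lra.
Qed.

(** Projection to the first two coordinates inverts [hemi], continuously up to the boundary, and
    also shows that its differential is injective. Differentiability fails only at the circle, where
    [rho] has a square-root singularity. *)
Lemma disc_embedding_hemi : disc_embedding hemi.
Proof.
split.
- split; first exact: continuous_subspaceT continuous_hemi.
  exists (fun z : 'rV[R]_4 => rv2 (z 0 0) (z 0 1)); split.
    apply: continuous_subspaceT => z.
    by apply: continuous_rv2; exact: coord_continuous.
  by move=> w _; rewrite hemiE; apply: eq_rv2; rewrite !rvE.
- exact: smooth_hemi.
- move=> w v w1 Dv.
  have dw : derivable hemi w v.
    by apply: diff_derivable; have [+ _] := smooth_hemi 1; exact.
  have e0 : ('D_v hemi w) 0 0 = v 0 0.
    rewrite derive_rV// (_ : (fun y => _) = fun y : 'rV[R]_2 => y 0 0).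
      exact: (@derive_val _ _ _ _ _ _ _ (is_derive_entry w v 0)).
    by apply/funext => y; rewrite hemiE rvE.
  have e1 : ('D_v hemi w) 0 1 = v 0 1.
    rewrite derive_rV// (_ : (fun y => _) = fun y : 'rV[R]_2 => y 0 1).
      exact: (@derive_val _ _ _ _ _ _ _ (is_derive_entry w v 1)).
    by apply/funext => y; rewrite hemiE rvE.
  rewrite Dv in e0 e1; rewrite !mxE in e0 e1. by apply: eq_rv2; rewrite -?e0 -?e1 !mxE.
Qed.

Lemma compact_disc : compact (@disc R).
Proof.
apply: bounded_closed_compact.
  exists 1; split; first exact: num_real.
  move=> x x1 w; rewrite /disc/= dot2E => w1.
  rewrite [leLHS]/Num.Def.normr/= mx_normrE.
  have le1 (t : R) : t * t <= 1 -> `|t| <= x.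
    move=> t1; rewrite (le_trans _ (ltW x1))//.
    by rewrite -sqrtr_sqr -sqrtr1 ler_wsqrtr.
  have h0 := sqr_ge0 (w 0 0); have h1 := sqr_ge0 (w 0 1).
  rewrite !expr2 in h0 h1.
  apply: bigmax_le => [|[i j] _ /=]; first by rewrite (le_trans _ (ltW x1)).
  rewrite ord1; apply: le1; move: j; apply: ord2P; lra.
apply: (@preimage_closed _ _ (fun p : 'rV[R]_2 => dot p p) [set x | x <= 1]).
  by move=> p _; exact: continuous_dot2.
exact: closed_le.
Qed.

Lemma compact_hemisphere : compact S.
Proof.
apply: continuous_compact; last exact: compact_disc.
exact: continuous_subspaceT continuous_hemi.
Qed.

Let sphereE (z : 'rV[R]_4) :
  sphere3 z = (z 0 0 ^+ 2 + z 0 1 ^+ 2 + z 0 2 ^+ 2 + z 0 3 ^+ 2 - 1 = 0).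
Proof.
rewrite /sphere3/= dot4E -!expr2; apply/propext; split=> [->|/eqP]; first by rewrite subrr.
by rewrite subr_eq0 => /eqP.
Qed.

Let open_pos (h : 'rV[R]_4 -> R) : (forall k, Ck k setT h) -> open [set z | 0 < h z].
Proof.
move=> hk; apply: (@open_comp _ _ h [set x | 0 < x]); last exact: open_gt.
by move=> z _; exact: (@Ck_continuous _ _ setT).
Qed.

Let sqrt_sign (e t : R) : e * e = 1 -> 0 < e * t -> e * Num.sqrt (t ^+ 2) = t.
Proof.
move=> e1 et; have -> : t ^+ 2 = (e * t) ^+ 2 by rewrite exprMn [e ^+ 2]e1 mul1r.
by rewrite sqrtr_sqr gtr0_norm// mulrA e1 mul1r.
Qed.

Let slice_chart (q : 'rV[R]_4) : Prop :=
  exists (U V : set 'rV[R]_4) (F G : 'rV[R]_4 -> 'rV[R]_4),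
    [/\ [/\ open U, open V & U q],
        smooth U F /\ smooth V G,
        forall x, U x -> V (F x) /\ G (F x) = x,
        forall y, V y -> U (G y) /\ F (G y) = y
      & forall x, U x ->
          (S x <-> [/\ 0 <= F x 0 0, F x 0 2 = 0 & F x 0 3 = 0]) /\
          (B x <-> [/\ F x 0 0 = 0, F x 0 2 = 0 & F x 0 3 = 0])].

(** Where the first coordinate has sign [e], the value of [|z|^2 - 1] and the other coordinates
    determine it, so they form a chart. The third coordinate of [z], which is nonnegative on the
    hemisphere and zero on its edge, becomes the half-space coordinate; the fourth one and
    [|z|^2 - 1] are the two that vanish on the surface. The next chart does the same with the second
    coordinate. *)
Let chart0 (e : R) (q : 'rV[R]_4) : e * e = 1 -> 0 < e * q 0 0 ->
  slice_chart q.
Proof.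
move=> e1 q0; have oT := @openT 'rV[R]_4.
pose h (y : 'rV[R]_4) := 1 + y 0 3 - y 0 0 ^+ 2 - y 0 1 ^+ 2 - y 0 2 ^+ 2.
pose U := [set z : 'rV[R]_4 | 0 < e * z 0 0].
pose V := [set y : 'rV[R]_4 | 0 < h y].
have oU : open U by apply: open_pos => k; ck oT.
have oV : open V by apply: open_pos => k; rewrite /h; ck oT.
exists U, V,
  (fun z : 'rV[R]_4 => rv4 (z 0 2) (z 0 1) (z 0 3)
     (z 0 0 ^+ 2 + z 0 1 ^+ 2 + z 0 2 ^+ 2 + z 0 3 ^+ 2 - 1)),
  (fun y : 'rV[R]_4 => rv4 (e * Num.sqrt (h y)) (y 0 1) (y 0 0) (y 0 2)).
split=> //.
- split=> k; first by apply: Ck_rv4 => //; ck oU.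
  apply: Ck_rv4 => //; try ck oV.
  by apply: (Ck_comp1 oV _ (smooth_sqrt k)) => //; rewrite /h; ck oV.
- move=> x Ux.
  have hx : h (rv4 (x 0 2) (x 0 1) (x 0 3)
     (x 0 0 ^+ 2 + x 0 1 ^+ 2 + x 0 2 ^+ 2 + x 0 3 ^+ 2 - 1)) = x 0 0 ^+ 2.
    by rewrite /h !rvE; ring.
  rewrite /V/= hx; split.
    rewrite lt_neqAle sqr_ge0 andbT eq_sym sqrf_eq0; apply/eqP => x0.
    by move: Ux; rewrite /U/= x0 mulr0 ltxx.
  by apply: eq_rv4; rewrite !rvE//; exact: sqrt_sign.
- move=> y Vy; split.
    by rewrite /U/= rvE mulrA e1 mul1r sqrtr_gt0.
  apply: eq_rv4; rewrite !rvE//.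
  rewrite exprMn [e ^+ 2]e1 mul1r sqr_sqrtr ?ltW//.
  by rewrite /h; ring.
- move=> x Ux; rewrite !rvE; split.
    by rewrite hemisphereP sphereE; split=> -[].
  by rewrite equatorP sphereE; split=> -[].
Qed.

Let chart1 (e : R) (q : 'rV[R]_4) : e * e = 1 -> 0 < e * q 0 1 ->
  slice_chart q.
Proof.
move=> e1 q0; have oT := @openT 'rV[R]_4.
pose h (y : 'rV[R]_4) := 1 + y 0 3 - y 0 0 ^+ 2 - y 0 1 ^+ 2 - y 0 2 ^+ 2.
pose U := [set z : 'rV[R]_4 | 0 < e * z 0 1].
pose V := [set y : 'rV[R]_4 | 0 < h y].
have oU : open U by apply: open_pos => k; ck oT.
have oV : open V by apply: open_pos => k; rewrite /h; ck oT.
exists U, V,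
  (fun z : 'rV[R]_4 => rv4 (z 0 2) (z 0 0) (z 0 3)
     (z 0 0 ^+ 2 + z 0 1 ^+ 2 + z 0 2 ^+ 2 + z 0 3 ^+ 2 - 1)),
  (fun y : 'rV[R]_4 => rv4 (y 0 1) (e * Num.sqrt (h y)) (y 0 0) (y 0 2)).
split=> //.
- split=> k; first by apply: Ck_rv4 => //; ck oU.
  apply: Ck_rv4 => //; try ck oV.
  by apply: (Ck_comp1 oV _ (smooth_sqrt k)) => //; rewrite /h; ck oV.
- move=> x Ux.
  have hx : h (rv4 (x 0 2) (x 0 0) (x 0 3)
     (x 0 0 ^+ 2 + x 0 1 ^+ 2 + x 0 2 ^+ 2 + x 0 3 ^+ 2 - 1)) = x 0 1 ^+ 2.
    by rewrite /h !rvE; ring.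
  rewrite /V/= hx; split.
    rewrite lt_neqAle sqr_ge0 andbT eq_sym sqrf_eq0; apply/eqP => x0.
    by move: Ux; rewrite /U/= x0 mulr0 ltxx.
  by apply: eq_rv4; rewrite !rvE//; exact: sqrt_sign.
- move=> y Vy; split.
    by rewrite /U/= rvE mulrA e1 mul1r sqrtr_gt0.
  apply: eq_rv4; rewrite !rvE//.
  rewrite exprMn [e ^+ 2]e1 mul1r sqr_sqrtr ?ltW//.
  by rewrite /h; ring.
- move=> x Ux; rewrite !rvE; split.
    by rewrite hemisphereP sphereE; split=> -[].
  by rewrite equatorP sphereE; split=> -[].
Qed.

(* Shifting the first coordinate by 2 makes the edge of the model half-space
   miss this interior chart. *)
Let chart2 (q : 'rV[R]_4) : 0 < q 0 2 -> 0 < q 0 0 + 2 ->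
  slice_chart q.
Proof.
move=> q2 q0; have oT := @openT 'rV[R]_4.
pose h (y : 'rV[R]_4) := 1 + y 0 3 - (y 0 0 - 2) ^+ 2 - y 0 1 ^+ 2 - y 0 2 ^+ 2.
pose U := [set z : 'rV[R]_4 | 0 < z 0 2] `&` [set z : 'rV[R]_4 | 0 < z 0 0 + 2].
pose V := [set y : 'rV[R]_4 | 0 < h y] `&` [set y : 'rV[R]_4 | 0 < y 0 0].
have oU : open U by apply: openI; apply: open_pos => k; ck oT.
have oV : open V by apply: openI; apply: open_pos => k; rewrite /h; ck oT.
exists U, V,
  (fun z : 'rV[R]_4 => rv4 (z 0 0 + 2) (z 0 1) (z 0 3)
     (z 0 0 ^+ 2 + z 0 1 ^+ 2 + z 0 2 ^+ 2 + z 0 3 ^+ 2 - 1)),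
  (fun y : 'rV[R]_4 => rv4 (y 0 0 - 2) (y 0 1) (Num.sqrt (h y)) (y 0 2)).
split=> //.
- split=> k; first by apply: Ck_rv4 => //; ck oU.
  apply: Ck_rv4 => //; try ck oV.
  by apply: (Ck_comp1 oV _ (smooth_sqrt k)) => [x []//|]; rewrite /h; ck oV.
- move=> x [/= x2 x0].
  have hx : h (rv4 (x 0 0 + 2) (x 0 1) (x 0 3)
     (x 0 0 ^+ 2 + x 0 1 ^+ 2 + x 0 2 ^+ 2 + x 0 3 ^+ 2 - 1)) = x 0 2 ^+ 2.
    by rewrite /h !rvE; ring.
  rewrite /V/= hx rvE; split; first by rewrite exprn_gt0.
  by apply: eq_rv4; rewrite !rvE ?addrK// sqrtr_sqr gtr0_norm.
- move=> y [/= Vy y0]; split.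
    by split; rewrite /= rvE ?subrK// sqrtr_gt0.
  apply: eq_rv4; rewrite !rvE ?subrK//.
  rewrite sqr_sqrtr ?ltW//.
  by rewrite /h; ring.
- move=> x [/= x2 x0]; rewrite !rvE; split.
    by rewrite hemisphereP sphereE; split=> -[? ? ?]; split=> //; exact: ltW.
  rewrite equatorP sphereE; split=> -[h1 h2 _]; first by rewrite h2 ltxx in x2.
  by rewrite h1 ltxx in x0.
Qed.

Lemma embedded_hemisphere : embedded_surface S B.
Proof.
split=> [z /equatorP[z1 z2 z3]|q /hemisphereP[q1 q2 q3]].
  by apply/hemisphereP; split=> //; rewrite z2.
have [q00|q00] := ltP 0 (q 0 0); first by apply: (@chart0 1); lra.
have [q01|q01] := ltP (q 0 0) 0; first by apply: (@chart0 (-1)); lra.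
have [q10|q10] := ltP 0 (q 0 1); first by apply: (@chart1 1); lra.
have [q11|q11] := ltP (q 0 1) 0; first by apply: (@chart1 (-1)); lra.
have q0 : q 0 0 = 0 by lra.
(* Only the pole [(0, 0, 1, 0)] of the hemisphere is left, an interior point. *)
apply: chart2; last by lra.
rewrite lt_neqAle q2 andbT eq_sym; apply/eqP => q20.
have e0 : q 0 1 = 0 by lra.
by move: q1; rewrite sphereE q0 e0 q20 q3 expr0n/=; lra.
Qed.

End Hemisphere.

(** * The contact form and its Reeb flow *)

Section ReebFlow.
(* [K] is the twisted Hamiltonian and [X] its vector field; near the boundary
   circle [K] is [f] in the variable [1 - |p|^2]. *)
Context {R : realType} (K : R -> 'rV[R]_2 -> R) (X : R -> 'rV[R]_2 -> 'rV[R]_2).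
Context (f : R -> R) (d : R).
Let K' (z : R * 'rV[R]_2) : R := K z.1 z.2.
Let W : set (R * 'rV[R]_2) := [set z | open_disc z.2].
Context (Ksm : smooth W K').
Context (Kper : forall s p, open_disc p -> K (s + 2 * pi) p = K s p).
Context (KX : forall s p v, open_disc p -> 'D_(0, v) K' (s, p) = omega (X s p) v).
Context (d0 : 0 < d) (fsm : smooth [set x | `|x| < d] f) (f0 : f 0 = 0).
Context (Kbd : forall s p, open_disc p -> 1 - dot p p < d -> K s p = f (1 - dot p p)).
(** The contact condition along the core circle [z2 = 0], where [G] has the value [f'(0)]. *)
Context (f'0 : 0 < 'D_1 f 0).
Context (m0 : R) (m00 : 0 < m0).
Context (Km0 : forall s p, open_disc p -> m0 <= K s p + lambda p (X s p)).
Context (phi : R -> 'rV[R]_2 -> 'rV[R]_2).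
Context (phiD : forall s p, open_disc p -> open_disc (phi s p)).
Context (phi0 : forall p, open_disc p -> phi 0 p = p).
Context (phiS : forall s q, open_disc q -> exists2 p, open_disc p & phi s p = q).
Context (dphi : forall s p, open_disc p ->
  is_derive s (1 : R) (phi^~ p) (X s (phi s p))).

Let Kpos s p : open_disc p -> 0 < K s p + lambda p (X s p).
Proof. by move=> p1; apply: lt_le_trans m00 _; exact: Km0. Qed.

(** * Smoothness of the coefficient [G] across the core circle *)

Let g (x : R) : R := if x == 0 then 'D_1 f 0 else f x / x.

(* The component of [z] in the disc factor, rescaled so that [Gfun] below is
   homogeneous of degree 0 and only values on the open disc are used. *)
Let pr (z : 'rV[R]_4) : 'rV[R]_2 :=
  rv2 (z 0 0 / Num.sqrt (nrm2 z)) (z 0 1 / Num.sqrt (nrm2 z)).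

(** A form on the sphere is encoded by a map that is smooth on a neighbourhood, so [K / (1 - |w|^2)]
    has to be extended off the sphere; note that [1 - |pr z|^2] is [rho2 z / nrm2 z]. On
    [rho2 z = 0] the value is the limit supplied by Hadamard's lemma. *)
Definition Gfun (z : 'rV[R]_4) : R :=
  if rho2 z == 0 then 'D_1 f 0 else K (arg z) (pr z) * nrm2 z / rho2 z.

Let dot_pr (z : 'rV[R]_4) : 0 < nrm2 z -> dot (pr z) (pr z) = 1 - rho2 z / nrm2 z.
Proof.
move=> n0; have r0 : Num.sqrt (nrm2 z) != 0 by rewrite lt0r_neq0// sqrtr_gt0.
have qq := sqr_sqrtr (ltW n0).
rewrite dot2E !rvE -{5}qq.
transitivity ((z 0 0 ^+ 2 + z 0 1 ^+ 2) / Num.sqrt (nrm2 z) ^+ 2); first by field.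
have -> : z 0 0 ^+ 2 + z 0 1 ^+ 2 = Num.sqrt (nrm2 z) ^+ 2 - rho2 z.
  by rewrite qq /nrm2; ring.
by field.
Qed.

Let pr_disc (z : 'rV[R]_4) : 0 < rho2 z -> 0 < nrm2 z -> open_disc (pr z).
Proof.
by move=> r0 n0; rewrite /open_disc/= dot_pr// ltrBlDr ltrDl divr_gt0.
Qed.

Let nrm2_gt0 (z : 'rV[R]_4) : 0 < rho2 z -> 0 < nrm2 z.
Proof. by rewrite /nrm2 => ?; nra. Qed.

(** By periodicity of [K], any angle of [z2] may stand in for [arg z]; a smooth local branch can
    then be chosen. *)
Let GfunE (z : 'rV[R]_4) s : 0 < rho2 z -> z 0 2 = Num.sqrt (rho2 z) * cos s ->
  z 0 3 = Num.sqrt (rho2 z) * sin s -> Gfun z = K s (pr z) * nrm2 z / rho2 z.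
Proof.
move=> r0 z2 z3; rewrite /Gfun gt_eqF//; congr (_ * _ / _).
have [_ _ c2 c3] := argP r0.
have q0 : Num.sqrt (rho2 z) != 0 by rewrite lt0r_neq0// sqrtr_gt0.
apply: (@periodic_angle _ _ (fun s => K s (pr z))).
- by move=> t; apply: Kper; apply: pr_disc => //; exact: nrm2_gt0.
- by apply: (mulfI q0); rewrite -c2.
- by apply: (mulfI q0); rewrite -c3.
Qed.

Lemma Gfun_sphere (z : 'rV[R]_4) s : sphere3 z -> 0 < rho2 z ->
  z 0 2 = Num.sqrt (rho2 z) * cos s -> z 0 3 = Num.sqrt (rho2 z) * sin s ->
  Gfun z = K s (rv2 (z 0 0) (z 0 1)) / rho2 z.
Proof.
rewrite /sphere3/= nrm2E => n1 r0 z2 z3.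
by rewrite (GfunE r0 z2 z3) /pr n1 sqrtr1 !divr1 mulr1.
Qed.

Let Ck_pr k (U : set 'rV[R]_4) : open U -> (forall z, U z -> 0 < nrm2 z) -> Ck k U pr.
Proof.
move=> oU Un.
have sq : Ck k U (fun z : 'rV[R]_4 => (Num.sqrt (nrm2 z))^-1).
  apply: CkV => // [z /Un n0|]; first by rewrite lt0r_neq0// sqrtr_gt0.
  by apply: (Ck_comp1 oU Un (smooth_sqrt k)); exact: Ck_nrm2.
by apply: Ck_rv2 => //; apply: (CkM oU) => //; exact: Ck_entry.
Qed.

(** With [u + i v = z2 e^(- i s0)], the function [s0 + atan (v / u)] is a smooth branch of the angle
    on the half-space [u > 0], which contains [z0]. *)
Let Ck_Gfun_off k (z0 : 'rV[R]_4) : 0 < rho2 z0 ->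
  exists A : set 'rV[R]_4, A z0 /\ Ck k A Gfun.
Proof.
move=> r0; have [_ _ z2 z3] := argP r0.
set s0 := arg z0 in z2 z3; set r := Num.sqrt (rho2 z0) in z2 z3.
have rr : 0 < r by rewrite sqrtr_gt0.
pose u (z : 'rV[R]_4) := cos s0 * z 0 2 + sin s0 * z 0 3.
pose v (z : 'rV[R]_4) := cos s0 * z 0 3 - sin s0 * z 0 2.
pose U := [set z : 'rV[R]_4 | 0 < u z].
have cu : continuous u.
  by move=> z; apply: (@Ck_continuous _ _ setT) => // k'; have o := @openT 'rV[R]_4; ck o.
have oU : open U.
  by apply: (@open_comp _ _ u [set x | 0 < x]); [move=> z _; exact: cu|exact: open_gt].
have uv z : rho2 z = u z ^+ 2 + v z ^+ 2.
  transitivity ((cos s0 ^+ 2 + sin s0 ^+ 2) * rho2 z); first by rewrite cos2Dsin2 mul1r.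
  by rewrite /rho2 /u /v; ring.
have rU z : U z -> 0 < rho2 z.
  rewrite uv /U/= => u0; have := sqr_ge0 (v z).
  by have := exprn_gt0 2 u0; lra.
have nU z : U z -> 0 < nrm2 z by move=> /rU/nrm2_gt0.
pose sf z := s0 + atan (v z / u z).
have sfE z : U z -> z 0 2 = Num.sqrt (rho2 z) * cos (sf z) /\
    z 0 3 = Num.sqrt (rho2 z) * sin (sf z).
  move=> Uz; have u0 : u z != 0 by rewrite gt_eqF.
  pose t := v z / u z; pose q := Num.sqrt (1 + t ^+ 2).
  have q0 : 0 < 1 + t ^+ 2 by have := sqr_ge0 t; lra.
  have qq : q != 0 by rewrite lt0r_neq0// sqrtr_gt0.
  have e : Num.sqrt (rho2 z) = u z * q.
    rewrite uv (_ : _ + _ = u z ^+ 2 * (1 + t ^+ 2)); last by rewrite /t; field.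
    by rewrite sqrtrM ?sqr_ge0// sqrtr_sqr gtr0_norm.
  have ct : cos (atan t) = q^-1 by rewrite cos_atan.
  have st : sin (atan t) = t / q.
    have /(congr1 (fun x => x * cos (atan t))) := atanK t.
    rewrite /tan -mulrA mulVf; last by rewrite ct invr_neq0.
    by rewrite mulr1 ct.
  have cs := cos2Dsin2 s0.
  rewrite /sf cosD sinD -/t ct st e; split.
    transitivity ((cos s0 ^+ 2 + sin s0 ^+ 2) * z 0 2); first by rewrite cs mul1r.
    by rewrite /t; transitivity (u z * cos s0 - v z * sin s0);
      [rewrite /u /v; ring|field; apply/andP].
  transitivity ((cos s0 ^+ 2 + sin s0 ^+ 2) * z 0 3); first by rewrite cs mul1r.
  by rewrite /t; transitivity (u z * sin s0 + v z * cos s0);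
    [rewrite /u /v; ring|field; apply/andP].
exists U; split.
  rewrite /U/= /u z2 z3 (_ : _ + _ = r * (cos s0 ^+ 2 + sin s0 ^+ 2)); last by ring.
  by rewrite cos2Dsin2 mulr1.
apply: (@Ck_eq _ _ _ _ _ (fun z => K' (sf z, pr z) * nrm2 z / rho2 z)) => //.
  by move=> z Uz; have [h2 h3] := sfE z Uz; rewrite (GfunE (rU _ Uz) h2 h3).
have u0 z : U z -> u z != 0 by move=> Uz; rewrite gt_eqF.
have cku : Ck k U u by rewrite /u; ck oU.
have ckv : Ck k U v by rewrite /v; ck oU.
have ckuV : Ck k U (fun z => (u z)^-1) by exact: CkV.
apply: (CkM oU).
  apply: (CkM oU); last exact: Ck_nrm2.
  apply: (Ck_comp_pair oU _ (Ksm k)); last exact: Ck_pr.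
    by move=> z Uz; apply: pr_disc; [exact: rU|exact: nU].
  apply: (CkD oU); first exact: Ck_cst.
  apply: (Ck_comp1 oU _ (smooth_atan k)) => //; exact: (CkM oU).
by apply: CkV => // [z /rU/lt0r_neq0//|]; exact: Ck_rho2.
Qed.

(** On the open cone [rho2 < d * nrm2] the Hamiltonian is radial, so [G] is the Hadamard quotient
    [g] of [f] evaluated at [rho2 / nrm2], and the angle drops out. *)
Let Ck_Gfun_on k (z0 : 'rV[R]_4) : rho2 z0 = 0 -> 0 < nrm2 z0 ->
  exists A : set 'rV[R]_4, A z0 /\ Ck k A Gfun.
Proof.
move=> r0 n0.
pose N := [set z : 'rV[R]_4 | 0 < nrm2 z].
have cont h : (forall k, Ck k setT h) -> continuous (h : 'rV[R]_4 -> R).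
  by move=> hk z; exact: (@Ck_continuous _ _ setT).
have o4 := @openT 'rV[R]_4.
have oN : open N.
  apply: (@open_comp _ _ nrm2 [set x | 0 < x]); last exact: open_gt.
  by move=> z _; apply: cont => j; exact: Ck_nrm2.
pose U := N `&` [set z | rho2 z - d * nrm2 z < 0].
have oU : open U.
  apply: openI => //.
  apply: (@open_comp _ _ (fun z => rho2 z - d * nrm2 z) [set x | x < 0]); last exact: open_lt.
  move=> z _; apply: cont => j.
  by apply: CkB => //; [exact: Ck_rho2|apply: CkM => //; [exact: Ck_cst|exact: Ck_nrm2]].
have Uz z : U z -> 0 < nrm2 z /\ `|rho2 z / nrm2 z| < d.
  move=> [/= n1 h]; split=> //.
  rewrite ger0_norm ?divr_ge0 ?rho2_ge0 ?(ltW n1)//.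
  by rewrite ltr_pdivrMr//; lra.
exists U; split; first by split=> //=; rewrite r0 sub0r oppr_lt0 mulr_gt0.
have gd := hadamard_quotient d0 fsm f0.
apply: (@Ck_eq _ _ _ _ _ (fun z => g (rho2 z / nrm2 z))) => //.
  move=> z /Uz[n1 rd]; rewrite /Gfun /g mulf_eq0 invr_eq0 (gt_eqF n1) orbF.
  case: eqP => // /eqP r1.
  have rp : 0 < rho2 z by rewrite lt_neqAle eq_sym r1 rho2_ge0.
  rewrite (Kbd _ (pr_disc rp n1)) dot_pr// opprB addrC subrK.
    by field; rewrite r1 gt_eqF.
  by move: rd; rewrite ltr_norml => /andP[].
apply: (@Ck_comp1 _ _ _ _ [set x | `|x| < d] g _ oU) => [z /Uz[]//||].
  exact: gd.
apply: CkM => //; first exact: Ck_rho2.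
by apply: CkV => // [z /Uz[/lt0r_neq0]//|]; exact: Ck_nrm2.
Qed.

Lemma smooth_Gfun : smooth [set z | 0 < dot z z] Gfun.
Proof.
move=> k; apply: Ck_local => z /=; rewrite nrm2E => n0.
have := rho2_ge0 z; rewrite le_eqVlt => /predU1P[r0|r0].
  exact: Ck_Gfun_on.
exact: Ck_Gfun_off.
Qed.

Lemma Gfun_circle z : rho2 z = 0 -> Gfun z = 'D_1 f 0.
Proof. by move=> r0; rewrite /Gfun r0 eqxx. Qed.

Definition alpha (z : 'rV[R]_4) : 'rV[R]_4 :=
  rv4 (- z 0 1) (z 0 0) (- (Gfun z * z 0 3)) (Gfun z * z 0 2).

Lemma smooth_alpha : smooth [set z | 0 < dot z z] alpha.
Proof.
move=> k; have oU : open [set z : 'rV[R]_4 | 0 < dot z z].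
  apply: (@open_comp _ _ (fun z : 'rV[R]_4 => dot z z) [set x | 0 < x]); last exact: open_gt.
  by move=> z _; exact: continuous_dot4.
have GU := smooth_Gfun k.
by apply: Ck_rv4 => //; ck oU.
Qed.

Let diffG z : sphere3 z -> differentiable Gfun z.
Proof.
move=> z1; have [+ _] := smooth_Gfun 1; apply.
by rewrite /= z1.
Qed.

(** * The differential of the form, and its pullback to the solid torus *)

Lemma dform1_alpha z u v : sphere3 z ->
  dform1 alpha z u v = 2 * (u 0 0 * v 0 1 - u 0 1 * v 0 0)
  + 2 * Gfun z * (u 0 2 * v 0 3 - u 0 3 * v 0 2)
  + 'D_u Gfun z * (z 0 2 * v 0 3 - z 0 3 * v 0 2)
  - 'D_v Gfun z * (z 0 2 * u 0 3 - z 0 3 * u 0 2).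
Proof.
move=> z1.
pose D (t : 'rV[R]_4) := rv4 (- t 0 1) (t 0 0)
    (- (Gfun z * t 0 3 + z 0 3 * 'D_t Gfun z)) (Gfun z * t 0 2 + z 0 2 * 'D_t Gfun z).
have Da t : 'D_t alpha z = D t.
  have dGt : is_derive z t Gfun ('D_t Gfun z).
    by split=> //; exact/diff_derivable/diffG.
  have crd i := is_derive_entry z t i.
  have H := is_derive_rv4 (is_derive_opp (crd 1)) (crd 0)
    (is_derive_opp (is_derive_mul dGt (crd 3))) (is_derive_mul dGt (crd 2)).
  exact: (@derive_val _ _ _ _ _ _ _ H).
transitivity (dot (D u) v - dot (D v) u).
  by rewrite /dform1; congr (_ - _); congr (dot _ _); exact: Da.
rewrite /D; move: (Gfun z) ('D_u Gfun z) ('D_v Gfun z) => y yu yv.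
by rewrite !dot4E !rvE; ring.
Qed.

(** The term with [dG] is multiplied by [x2 dy2 - y2 dx2], which vanishes on the core circle, so
    only the value of [G] there survives. *)
Lemma dform1_alpha_circle z u v : sphere3 z -> rho2 z = 0 ->
  dform1 alpha z u v = 2 * (u 0 0 * v 0 1 - u 0 1 * v 0 0)
  + 2 * 'D_1 f 0 * (u 0 2 * v 0 3 - u 0 3 * v 0 2).
Proof.
move=> z1 r0; have [z2 z3] := rho2_eq0 r0.
rewrite dform1_alpha// (Gfun_circle r0) z2 z3.
by move: ('D_1 f 0) ('D_u Gfun z) ('D_v Gfun z) => y yu yv; ring.
Qed.

Lemma Gfun_Psi s w : open_disc w -> Gfun (Psi s w) = K s w / (1 - dot w w).
Proof.
move=> w1; have w1' := open_discW w1.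
have r : rho2 (Psi s w) = 1 - dot w w by exact: rho2_Psi.
rewrite (@Gfun_sphere _ s) ?r ?rvE//; last 2 first.
- exact: dot_Psi.
- by rewrite subr_gt0.
by congr (K s _ / _); apply: eq_rv2; rewrite rvE.
Qed.

Lemma diffK s w : open_disc w -> differentiable K' (s, w).
Proof. by move=> w1; have [+ _] := Ksm 1; apply. Qed.

(** A straight line in the direction [dPsi] leaves the sphere, where [G] has no simple formula.
    Instead both sides of [G (Psi s w) = K s w / (1 - |w|^2)] are differentiated along the image of
    a line in the coordinates [(s, w)]. *)
Lemma derive_Gfun s w sg v : open_disc w ->
  'D_(dPsi s w sg v) Gfun (Psi s w) = 'd K' (s, w) (sg, v) / rho w ^+ 2
    + 2 * K s w * dot w v / rho w ^+ 4.
Proof.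
move=> w1; have w1' := open_discW w1.
pose th (t : R) := s + t * sg; pose c (t : R) := w + t *: v.
have th0 : th 0 = s by rewrite /th mul0r addr0.
have c0 : c 0 = w by rewrite /c scale0r addr0.
have dth : is_derive (0 : R) (1 : R) th sg.
  apply: (is_derive_eq (is_derive_add (is_derive_cst s (0 : R) 1)
    (is_derive_mul (is_derive_id _ _) (is_derive_cst sg (0 : R) 1)))).
  by rewrite /cst mulr0 mulr1 !add0r.
have dc : is_derive (0 : R) (1 : R) c v.
  apply: is_derive_rV => i.
  under eq_fun do rewrite !mxE.
  apply: (is_derive_eq (is_derive_add (is_derive_cst (w 0 i) (0 : R) 1)
    (is_derive_mul (is_derive_id _ _) (is_derive_cst (v 0 i) (0 : R) 1)))).
  by rewrite /cst mulr0 mulr1 !add0r.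
have c01 : open_disc (c 0) by rewrite c0.
have dPsi0 := is_derive_Psi c01 dth dc.
have dG0 : differentiable Gfun (Psi (th 0) (c 0)).
  by apply: diffG; rewrite /sphere3/= dot_Psi// c0.
have H1 := @is_derive_along _ _ _ Gfun (fun u => Psi (th u) (c u)) 0 _ dG0 dPsi0.
have dK0 : differentiable K' (th 0, c 0) by exact: diffK.
have H2 := is_derive_comp_pair dK0 dth dc.
have H3 := is_derive_sub (is_derive_cst (1 : R) (0 : R) 1) (is_derive_dot2 dc).
have n0 : 1 - dot (c 0) (c 0) != 0 by rewrite gt_eqF// subr_gt0.
have H4 := is_derive_mul H2 (@is_derive_inv _ _ (fun t => 1 - dot (c t) (c t)) _ _ _ n0 H3).
have H5 : \forall t \near (0 : R), K' (th t, c t) / (1 - dot (c t) (c t)) = Gfun (Psi (th t) (c t)).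
  have cc : {for (0 : R), continuous c}.
    by apply/differentiable_continuous/derivable1_diffP; exact: ex_derive.
  have : \forall t \near (0 : R), open_disc (c t).
    apply: cc; apply: open_nbhs_nbhs; split; [exact: open_open_disc|exact: c01].
  by apply: filterS => t ct; rewrite Gfun_Psi.
have := is_derive_uniq H1 (near_eq_is_derive H5 H4).
rewrite /= th0 c0 => ->; rewrite /cst.
have -> : rho w ^+ 4 = (rho w ^+ 2) ^+ 2 by rewrite -exprM.
rewrite sqr_rho// /K'/=; rewrite c0 in n0.
by field.
Qed.

Lemma diffKE s w sg v : open_disc w ->
  'd K' (s, w) (sg, v) = sg * 'd K' (s, w) (1, 0) + omega (X s w) v.
Proof.
move=> w1; rewrite -KX// (deriveE _ (diffK s w1)).
rewrite -[_ * _]/(_ *: _) -linearZ -linearD; congr ('d _ _ _).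
by apply/pair_equal_spec; split=> /=; rewrite ?addr0 ?scaler0 ?add0r//; exact/esym/mulr1.
Qed.

(** This is the identity that [d alpha] pulls back to [omega + dK /\ ds]. The [s]-derivative of [K]
    cancels because [ds /\ ds = 0], and the rest of [dK] is [omega(X, .)]. *)
Lemma dform1_Psi s w sg v sg' v' : open_disc w ->
  dform1 alpha (Psi s w) (dPsi s w sg v) (dPsi s w sg' v') =
  omega v v' + omega (X s w) v * sg' - omega (X s w) v' * sg.
Proof.
move=> w1; have w1' := open_discW w1.
have r0 : rho w != 0 by rewrite lt0r_neq0// rho_gt0.
rewrite dform1_alpha; last exact: dot_Psi.
rewrite !derive_Gfun// Gfun_Psi// -sqr_rho// !rvE.
have cs := cos2Dsin2 s.
(* In the coordinates of the torus, [x2 dy2 - y2 dx2] is [rho^2 ds], and below [dx2 /\ dy2] is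
   [rho drho /\ ds]. *)
have e1 t y : rho w * cos s * (- (dot w y / rho w) * sin s + rho w * cos s * t) -
    rho w * sin s * (- (dot w y / rho w) * cos s - rho w * sin s * t) = rho w ^+ 2 * t.
  by transitivity (rho w ^+ 2 * t * (cos s ^+ 2 + sin s ^+ 2)); [ring|rewrite cs mulr1].
rewrite !e1.
have e2 : (- (dot w v / rho w) * cos s - rho w * sin s * sg) *
    (- (dot w v' / rho w) * sin s + rho w * cos s * sg') -
    (- (dot w v / rho w) * sin s + rho w * cos s * sg) *
    (- (dot w v' / rho w) * cos s - rho w * sin s * sg') =
    dot w v' * sg - dot w v * sg'.
  transitivity ((dot w v' * sg - dot w v * sg') * (cos s ^+ 2 + sin s ^+ 2)); last first.
    by rewrite cs mulr1.
  by field.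
rewrite e2 (diffKE s sg v w1) (diffKE s sg' v' w1) /omega.
by field.
Qed.

Lemma form1_Psi s w sg v : open_disc w ->
  form1 alpha (Psi s w) (dPsi s w sg v) = lambda w v + K s w * sg.
Proof.
move=> w1; have w1' := open_discW w1.
have r0 : rho w != 0 by rewrite lt0r_neq0// rho_gt0.
rewrite /form1 dot4E /alpha !rvE Gfun_Psi// -sqr_rho//.
transitivity (lambda w v + K s w * sg * (cos s ^+ 2 + sin s ^+ 2)).
  by rewrite /lambda; field.
by rewrite cos2Dsin2 mulr1.
Qed.

(** The field [d/ds + X] divided by its value under [alpha]. On the core circle, where [s] is
    undefined, it is the unit rotation of the first factor. *)
Definition reebX (z : 'rV[R]_4) : 'rV[R]_4 :=
  if rho2 z == 0 then rv4 (- z 0 1) (z 0 0) 0 0 else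
  let s := arg z in let w := rv2 (z 0 0) (z 0 1) in
  (K s w + lambda w (X s w))^-1 *: dPsi s w 1 (X s w).

(** Nondegeneracy of [omega]: two test vectors recover [X] from [dK], which is periodic. *)
Let Xper s p : open_disc p -> X (s + 2 * pi) p = X s p.
Proof.
move=> p1.
have e v : omega (X (s + 2 * pi) p) v = omega (X s p) v.
  rewrite -!KX// !derive_slice; apply: near_eq_derive.
  have : \forall q \near p, open_disc q.
    by apply: open_nbhs_nbhs; split=> //; exact: open_open_disc.
  by apply: filterS => q q1; exact: Kper.
have e0 := e (rv2 1 0); have e1 := e (rv2 0 1).
by rewrite /omega !rvE in e0 e1; apply: eq_rv2; lra.
Qed.

Lemma reebX_Psi s w : open_disc w ->
  reebX (Psi s w) = (K s w + lambda w (X s w))^-1 *: dPsi s w 1 (X s w).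
Proof.
move=> w1; have w1' := open_discW w1.
have r : rho2 (Psi s w) = 1 - dot w w by exact: rho2_Psi.
have r0 : 0 < rho2 (Psi s w) by rewrite r subr_gt0.
have [_ _ z2 z3] := argP r0.
rewrite /reebX gt_eqF// !rvE.
have -> : rv2 (w 0 0) (w 0 1) = w by apply: eq_rv2; rewrite rvE.
have q0 : Num.sqrt (rho2 (Psi s w)) != 0 by rewrite lt0r_neq0// sqrtr_gt0.
rewrite !rvE in z2 z3.
have rhoE : rho w = Num.sqrt (rho2 (Psi s w)) by rewrite r.
apply: (@periodic_angle _ _ (fun s => (K s w + lambda w (X s w))^-1 *: dPsi s w 1 (X s w))).
- move=> t; rewrite Kper// Xper//; congr (_ *: _).
  by rewrite /dPsi mulr_natl cosD2pi sinD2pi.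
- by apply: (mulfI q0); rewrite -z2 rhoE.
- by apply: (mulfI q0); rewrite -z3 rhoE.
Qed.

Lemma contact_alpha : contact_form alpha.
Proof.
split.
  exists [set z | 0 < dot z z]; split.
  - apply: (@open_comp _ _ (fun z : 'rV[R]_4 => dot z z) [set x | 0 < x]); last exact: open_gt.
    by move=> z _; exact: continuous_dot4.
  - by move=> z; rewrite /sphere3/= => ->.
  - exact: smooth_alpha.
move=> z z1; have := rho2_ge0 z; rewrite le_eqVlt => /predU1P[/esym r0|r0].
  have [z2 z3] := rho2_eq0 r0.
  have e1 : z 0 0 ^+ 2 + z 0 1 ^+ 2 = 1.
    by move: z1; rewrite /sphere3/= nrm2E /nrm2 r0 addr0.
  (* The tangent of the core circle together with its two normal directions in the sphere; the
     3-form takes the value [2 f'(0)] on this frame. *)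
  exists (rv4 (- z 0 1) (z 0 0) 0 0), (rv4 0 0 1 0), (rv4 0 0 0 1); split;
    try by rewrite /tangent3/= dot4E !rvE ?z2 ?z3; ring.
  rewrite /wedge_d !dform1_alpha_circle// /form1 !dot4E !rvE z2 z3.
  rewrite (_ : _ + _ = 2 * 'D_1 f 0 * (z 0 0 ^+ 2 + z 0 1 ^+ 2)); last by ring.
  by rewrite e1 mulr1 mulf_neq0// ?pnatr_eq0// gt_eqF.
have [w1 ->] := Psi_surj z1 r0; set s := arg z; set w := rv2 _ _ in w1 *.
(* As [d/ds + X] annihilates [d alpha], the 3-form on this frame is [alpha(d/ds + X)] times the
   [omega]-area 2 of the unit square. *)
exists (dPsi s w 1 (X s w)), (dPsi s w 0 (rv2 1 0)), (dPsi s w 0 (rv2 0 1)).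
split; try exact: tangent_dPsi.
rewrite /wedge_d !dform1_Psi// !form1_Psi//.
rewrite (_ : _ + _ = 2 * (K s w + lambda w (X s w))).
  by rewrite mulf_neq0 ?pnatr_eq0// gt_eqF// Kpos.
by rewrite /omega /lambda !rvE; ring.
Qed.

Lemma reeb_reebX : reeb_field alpha reebX.
Proof.
move=> z z1; have := rho2_ge0 z; rewrite le_eqVlt => /predU1P[/esym r0|r0].
  have [z2 z3] := rho2_eq0 r0.
  have e1 : z 0 0 ^+ 2 + z 0 1 ^+ 2 = 1.
    by move: z1; rewrite /sphere3/= nrm2E /nrm2 r0 addr0.
  rewrite /reebX r0 eqxx; split.
  - by rewrite /tangent3/= dot4E !rvE; ring.
  - by rewrite /form1 dot4E !rvE -[RHS]e1; ring.
  (* Here [d alpha] of the rotation field and [v] is [-2 <z, v>], which vanishes for tangent [v]. *)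
  - move=> v; rewrite /tangent3/= dot4E z2 z3 !mul0r !addr0 => tv.
    rewrite dform1_alpha_circle// !rvE.
    by rewrite -[RHS](mulr0 (-2)) -[in RHS]tv; ring.
have [w1 ->] := Psi_surj z1 r0; set s := arg z; set w := rv2 _ _ in w1 *.
have mX : K s w + lambda w (X s w) != 0 by rewrite gt_eqF// Kpos.
rewrite reebX_Psi// dPsiZ; split.
- exact: tangent_dPsi.
- rewrite form1_Psi//.
  have -> : lambda w ((K s w + lambda w (X s w))^-1 *: X s w) =
      (K s w + lambda w (X s w))^-1 * lambda w (X s w).
    by rewrite /lambda !mxE; ring.
  by rewrite mulr1 mulrC -mulrDl addrC divff.
- move=> v /(dPsi_surj w1)[sg [v' ->]].
  rewrite dform1_Psi// /omega !mxE.
  by ring.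
Qed.

(** * Reeb orbits as reparametrised Hamiltonian orbits *)

Let orbit_mass p0 s := K s (phi s p0) + lambda (phi s p0) (X s (phi s p0)).

(** [orbit_mass] is the rate [dt/ds] of Reeb time along a Hamiltonian orbit, to be inverted by the
    time change. No continuity of [X] is assumed; it is replaced by the identity
    [lambda(X) = - (r/2) dK/dr], written with the two partial derivatives of [K]. *)
Let continuous_orbit_mass p0 : open_disc p0 -> continuous (orbit_mass p0).
Proof.
move=> p1.
have massE s p : open_disc p -> K s p + lambda p (X s p) =
    K' (s, p) - (p 0 0 * 'D_(0, rv2 1 0) K' (s, p) + p 0 1 * 'D_(0, rv2 0 1) K' (s, p)) / 2.
  by move=> pd; rewrite !KX// /omega /lambda !rvE /K'/=; field.
rewrite (_ : orbit_mass p0 = fun s => K' (s, phi s p0) -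
    (phi s p0 0 0 * 'D_(0, rv2 1 0) K' (s, phi s p0) +
     phi s p0 0 1 * 'D_(0, rv2 0 1) K' (s, phi s p0)) / 2); last first.
  by apply/funext => s; rewrite /orbit_mass massE//; exact: phiD.
move=> s.
have cphi : {for s, continuous (phi^~ p0)}.
  by apply/differentiable_continuous/derivable1_diffP; have [] := dphi s p1.
have cpair : {for s, continuous (fun t => (t, phi t p0))}.
  exact: (cvg_pair cvg_id cphi).
have ccomp (h : R * 'rV[R]_2 -> R) : Ck 0 W h ->
    {for s, continuous (fun t => h (t, phi t p0))}.
  move=> hW; apply: (@continuous_comp _ _ _ (fun t => (t, phi t p0)) h) => //.
  by apply: hW; exact: phiD.
have cent i : {for s, continuous (fun t => phi t p0 0 i)}.
  apply: (@continuous_comp _ _ _ (phi^~ p0) (fun v : 'rV[R]_2 => v 0 i)) => //.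
  exact: coord_continuous.
have [_ DK] := Ksm 1.
have cK := ccomp _ (Ksm 0%N).
have c0 := ccomp _ (DK (0, rv2 1 0)).
have c1 := ccomp _ (DK (0, rv2 0 1)).
exact: (cvgB cK (cvgM (cvgD (cvgM (cent 0) c0) (cvgM (cent 1) c1)) (cvg_cst _))).
Qed.

(** Each orbit is recorded with its explicit form, from which the return map is read off later. The
    premise [sphere3 z] stands under the existential so that [choice] gives one map for all [z]. The
    point [p] is where the Hamiltonian orbit through [z] was at [s = 0]. *)
Let orbit_exists (z : 'rV[R]_4) : exists c : R -> 'rV[R]_4, sphere3 z ->
  [/\ c 0 = z,
      forall t, sphere3 (c t) /\ is_derive t (1 : R) c (reebX (c t)),
      rho2 z = 0 -> forall t, c t = rv4 (z 0 0 * cos t - z 0 1 * sin t)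
                                        (z 0 0 * sin t + z 0 1 * cos t) 0 0
    & 0 < rho2 z -> exists (sg : R -> R) (p : 'rV[R]_2),
        [/\ open_disc p, phi (arg z) p = rv2 (z 0 0) (z 0 1),
            forall t, c t = Psi (sg t) (phi (sg t) p), sg 0 = arg z
          & (forall s, exists t, sg t = s) /\ {mono sg : t u / t < u}]].
Proof.
have [z1|nz1] := pselect (sphere3 z); last by exists (fun=> 0) => /nz1.
have := rho2_ge0 z; rewrite le_eqVlt => /predU1P[/esym r0|r0].
  have [z2 z3] := rho2_eq0 r0.
  have e1 : z 0 0 ^+ 2 + z 0 1 ^+ 2 = 1.
    by move: z1; rewrite /sphere3/= nrm2E /nrm2 r0 addr0.
  exists (fun t => rv4 (z 0 0 * cos t - z 0 1 * sin t)
                       (z 0 0 * sin t + z 0 1 * cos t) 0 0) => _; split.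
  - by rewrite cos0 sin0; apply: eq_rv4; rewrite !rvE ?z2 ?z3//; ring.
  - move=> t; split.
      rewrite /sphere3/= dot4E !rvE -[RHS]mulr1 -[X in _ = _ * X](cos2Dsin2 t) -e1.
      by ring.
    have r1 : rho2 (rv4 (z 0 0 * cos t - z 0 1 * sin t)
                        (z 0 0 * sin t + z 0 1 * cos t) 0 0) = 0.
      by rewrite /rho2 !rvE; ring.
    rewrite /reebX r1 eqxx !rvE.
    have [dc ds] := (is_derive_cos t, is_derive_sin t).
    have [c0 c1] := (is_derive_cst (z 0 0) t (1 : R), is_derive_cst (z 0 1) t (1 : R)).
    apply: is_derive_rv4; try exact: is_derive_cst.
      apply: (is_derive_eq (is_derive_sub (is_derive_mul c0 dc) (is_derive_mul c1 ds))).
      by rewrite /cst; ring.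
    apply: (is_derive_eq (is_derive_add (is_derive_mul c0 ds) (is_derive_mul c1 dc))).
    by rewrite /cst; ring.
  - by [].
  - by rewrite r0 ltxx.
have [w1 zE] := Psi_surj z1 r0.
have [p p1 pw] := phiS (arg z) w1.
have [sg [sg0 dsg sgS sgM]] := @time_change R (orbit_mass p) m0 (arg z)
  (continuous_orbit_mass p1) m00 (fun s => Km0 s (phiD s p1)).
exists (fun t => Psi (sg t) (phi (sg t) p)) => _; split.
- by rewrite sg0 pw -zE.
- move=> t; have pd := phiD (sg t) p1; split; first exact/dot_Psi/open_discW.
  have dc := @is_derive_chain _ _ (phi^~ p) sg _ _ _ (dphi (sg t) p1) (dsg t).
  apply: (is_derive_eq (@is_derive_Psi _ sg (fun t => phi (sg t) p) t _ _ pd (dsg t) dc)).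
  by rewrite reebX_Psi// dPsiZ mulr1.
- by move=> r0'; move: r0; rewrite r0' ltxx.
- by move=> _; exists sg, p; split.
Qed.

Let flow_exists := choice orbit_exists.

Let is_derive_entry3 (c : R -> 'rV[R]_4) (U : set R) v : open U -> U 0 ->
  (forall t, U t -> c t 0 3 = 0) -> is_derive (0 : R) (1 : R) c v -> v 0 3 = 0.
Proof.
move=> oU U0 cU dc.
apply: (is_derive_uniq (is_derive_coord dc 3)).
apply: (@near_eq_is_derive _ _ _ (cst 0)).
have : \forall t \near (0 : R), U t by exact: open_nbhs_nbhs.
by apply: filterS => t Ut; rewrite cU.
Qed.

Theorem mapping_torus_embeds (psi : 'rV[R]_2 -> 'rV[R]_2) :
  (forall p, open_disc p -> psi p = phi (2 * pi) p) ->
  embeds_into_Reeb_flow_on_S3 psi.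
Proof.
move=> psiE; have [c cP] := flow_exists; have pi0 := pi_gt0 R.
have cos2pi' : cos (2 * pi) = 1 :> R by rewrite mulr_natl cos2pi.
have sin2pi' : sin (2 * pi) = 0 :> R by rewrite mulr_natl sin2pi.
exists alpha, reebX, (fun (t : R) z => c z t), hemi => S B; split.
- split.
  + exact: contact_alpha.
  + exact: reeb_reebX.
  + by move=> z z1; have [h0 h1 _ _] := cP z z1.
- exact: disc_embedding_hemi.
- split.
  + split; last exact: compact_hemisphere.
    by move=> z /hemisphereP[].
  + exact: embedded_hemisphere.
  + move=> p pB; have /equatorP[p1 p2 p3] := pB.
    have r0 : rho2 p = 0 by rewrite /rho2 p2 p3; ring.
    have [_ _ /(_ r0) cE _] := cP p p1.
    have e1 : p 0 0 ^+ 2 + p 0 1 ^+ 2 = 1.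
      by move: p1; rewrite /sphere3/= nrm2E /nrm2 r0 addr0.
    have orbB : B = Defs.orbit (fun (t : R) z => c z t) p.
      apply/seteqP; split=> [z /equatorP[z1 z2 z3]|_ [t _ <-]].
        have r0' : rho2 z = 0 by rewrite /rho2 z2 z3; ring.
        have e2 : z 0 0 ^+ 2 + z 0 1 ^+ 2 = 1.
          by move: z1; rewrite /sphere3/= nrm2E /nrm2 r0' addr0.
        (* The time from [p] to [z] is the argument of [z1] times the conjugate of [p1], for the
           first complex coordinates. *)
        have [|s [_ _ sc ss]] := @angle_exists R (p 0 0 * z 0 0 + p 0 1 * z 0 1)
            (p 0 0 * z 0 1 - p 0 1 * z 0 0).
          transitivity ((p 0 0 ^+ 2 + p 0 1 ^+ 2) * (z 0 0 ^+ 2 + z 0 1 ^+ 2)).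
            by ring.
          by rewrite e1 e2 mulr1.
        exists s => //; rewrite cE -sc -ss; apply: eq_rv4; rewrite !rvE ?z2 ?z3//.
          by rewrite -[RHS]mul1r -e1; ring.
        by rewrite -[RHS]mul1r -e1; ring.
      apply/equatorP; rewrite cE !rvE; split=> //.
      rewrite /sphere3/= dot4E !rvE -[RHS]mulr1 -[X in _ = _ * X](cos2Dsin2 t) -e1.
      by ring.
    exists p, (2 * pi); split.
    * by rewrite mulr_gt0.
    * by rewrite cE cos2pi' sin2pi'; apply: eq_rv4; rewrite !rvE ?p2 ?p3//; ring.
    * rewrite -orbB; apply: connected_component_id => //.
      rewrite orbB; apply: connected_continuous_connected.
        by apply/connected_intervalP.
      apply: continuous_subspaceT => t.
      have [_ /(_ t)[_ [dc _]] _ _] := cP p p1.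
      exact/differentiable_continuous/derivable1_diffP.
  (* Transversality is visible in the last coordinate: it is 0 for velocities of curves in [S], and
     [rho cos s / (K + lambda(X)) > 0] for the Reeb field. *)
  + move=> z /hemisphere_interiorP[z1 z2 z3] [U [k [[oU U0 _ kS k0] dk]]].
    have r0 : 0 < rho2 z by rewrite /rho2; nra.
    have [w1 zE] := Psi_surj z1 r0.
    have X3 : (reebX z) 0 3 = 0.
      by apply: (is_derive_entry3 oU U0 _ dk) => t /kS /hemisphereP[].
    move: X3; rewrite zE reebX_Psi//.
    set s := arg z; set w := rv2 _ _ in w1 zE *.
    have rw := rho_gt0 w1.
    rewrite mxE rvE mulr1.
    have s0 : sin s = 0.
      by move: z3; rewrite zE rvE => /eqP; rewrite mulf_eq0 (gt_eqF rw) => /eqP.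
    have c0 : 0 < rho w * cos s by move: z2; rewrite zE rvE.
    rewrite s0 mulr0 add0r => /eqP; rewrite mulf_eq0 invr_eq0 => /orP[].
      by rewrite gt_eqF// Kpos.
    by rewrite gt_eqF.
  + move=> z [z1 nB].
    have r0 : 0 < rho2 z.
      rewrite lt_neqAle rho2_ge0 andbT eq_sym; apply/eqP => /rho2_eq0[z2 z3].
      by apply: nB; apply/equatorP.
    have [c0 cS _ /(_ r0)[sg [p [p1 pw cE sg0 [sgS sgM]]]]] := cP z z1.
    have [a0 a2 _ _] := argP r0.
    have hit t : cos (sg t) = 1 -> sin (sg t) = 0 -> (S `\` B) (c z t).
      move=> ct st; apply/hemisphere_interiorP; split; first by have [] := cS t.
        by rewrite cE rvE ct mulr1 rho_gt0//; exact: phiD.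
      by rewrite cE rvE st mulr0.
    split.
      (* As [arg z] lies in [[0, 2 pi)], the value [2 pi] is strictly ahead. For the backward hit
         [- 2 pi] is used, since [arg z] may be 0. *)
      have [t tE] := sgS (2 * pi); exists t; last by apply: hit; rewrite tE.
      by rewrite -sgM sg0 tE.
    have [t tE] := sgS (- (2 * pi)); exists t; last first.
      by apply: hit; rewrite tE ?cosN ?sinN ?sin2pi' ?oppr0.
    by rewrite -sgM sg0 tE; lra.
- move=> w w1.
  have z1 : sphere3 (hemi w) by exact/dot_Psi/open_discW.
  have r : rho2 (hemi w) = 1 - dot w w by exact/rho2_Psi/open_discW.
  have r0 : 0 < rho2 (hemi w) by rewrite r subr_gt0.
  have [c0 cS _ /(_ r0)[sg [p [p1 pw cE sg0 [sgS sgM]]]]] := cP _ z1.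
  have [a0 a2 a3 _] := argP r0.
  have arg0 : arg (hemi w) = 0.
    apply: cos_eq1_lt2pi => //.
    have q0 : Num.sqrt (rho2 (hemi w)) != 0 by rewrite lt0r_neq0// sqrtr_gt0.
    by apply: (mulfI q0); rewrite -a3 mulr1 r hemiE rvE.
  have pw' : p = w.
    move: pw; rewrite arg0 phi0// => ->.
    by apply: eq_rv2; rewrite hemiE !rvE.
  subst p.
  have int v : open_disc v -> (S `\` B) (hemi v).
    move=> v1; apply/hemisphere_interiorP; split; first exact/dot_Psi/open_discW.
      by rewrite hemiE rvE rho_gt0.
    by rewrite hemiE rvE.
  split; first by apply: int; rewrite psiE//; exact: phiD.
  have [t tE] := sgS (2 * pi); exists t; split.
  + by rewrite -sgM sg0 tE arg0 mulr_gt0.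
  + by rewrite cE tE /hemi psiE// /Psi cos2pi' sin2pi' cos0 sin0.
  (* An earlier return would have [sin s = 0] and [cos s > 0], hence [cos s = 1], with
     [0 < s < 2 pi]. *)
  + move=> u u0 ut /hemisphere_interiorP[_].
    rewrite cE !rvE => h2 /eqP; have rr := rho_gt0 (phiD (sg u) w1).
    rewrite mulf_eq0 (gt_eqF rr)/= => /eqP h3.
    move: u0 ut; rewrite -(sgM 0 u) -(sgM u t) sg0 tE arg0 => s0 s2.
    have cpos : 0 < cos (sg u) by move: h2; rewrite pmulr_rgt0.
    have c1 : cos (sg u) = 1.
      have := cos2Dsin2 (sg u); rewrite h3 expr0n/= addr0 => /eqP.
      by rewrite sqrf_eq1 => /orP[/eqP//|/eqP cN]; rewrite cN in cpos; lra.
    by have := cos_eq1_lt2pi (ltW s0) s2 c1; lra.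
Qed.

End ReebFlow.

(** * Twisting the Hamiltonian *)

Section WithinDisc.
Context {R : realType}.

Lemma smooth_on_smooth (V W : normedModType R) (A O : set V) (f : V -> W) :
  smooth_on A f -> open O -> O `<=` A -> smooth O f.
Proof.
move=> fA oO OA k; apply: Ck_local => x Ox.
have [U [g [oU Ux gU gf]]] := fA _ (OA _ Ox).
exists (U `&` O); split=> //; apply: (@Ck_eq _ _ _ _ _ g).
- exact: openI.
- by move=> y [Uy Oy]; apply: gf => //; exact: OA.
- by apply: Ck_sub (gU k) => y [].
Qed.

(** A chain rule along maps that stay in [A]. With the identity it gives ordinary differentiability
    at interior points; with a rotation curve it remains usable at boundary points of the disc,
    where only the relative differential exists. *)
Lemma diff_within_comp (V W : normedModType R) (A : set V) (f : V -> R)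
    (L : {linear V -> R}) (c : W -> V) (x : W) : continuous L ->
  is_diff_within A f (c x) L -> (\forall y \near x, A (c y)) ->
  differentiable c x ->
  differentiable (fun y => f (c y)) x /\
  forall v, 'd (fun y => f (c y)) x v = L ('d c x v).
Proof.
move=> Lc fL cA dc.
have cc : {for x, continuous c} by exact: differentiable_continuous.
pose L' : {linear W -> R} := L \o 'd c x.
have L'c : continuous L'.
  by move=> y; apply: continuous_comp; [exact: diff_continuous|exact: Lc].
have [k1 k10 Lk] := linear_lipschitz Lc.
have [k2 k20 ck] := linear_lipschitz (diff_continuous dc).
suff H : differentiable (fun y => f (c y)) x /\ 'd (fun y => f (c y)) x = L' :> (W -> R).
  by have [h1 h2] := H; split=> // v; rewrite h2.
apply: near_differentiable => // e e0.
(* Each error source gets [e / 2]: since [e2 <= 1], [c] moves by at most [(k2 + 1) |y - x|], and [L]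
   magnifies the error of [c] by at most [k1]. *)
pose e1 := e / (2 * (k2 + 1)); pose e2 := Num.min 1 (e / (2 * k1)).
have e10 : 0 < e1 by rewrite divr_gt0// mulr_gt0// addr_gt0.
have e20 : 0 < e2 by rewrite lt_min ltr01 divr_gt0// mulr_gt0.
have Hc := differentiable_near dc e20.
have Hf : \forall y \near x, A (c y) -> `|f (c y) - f (c x) - L (c y - c x)| <= e1 * `|c y - c x|.
  by have H := fL _ e10; rewrite near_withinE in H; exact: (cc _ H).
near=> y.
have h1 : `|c y - c x - 'd c x (y - x)| <= e2 * `|y - x| by near: y.
have h2 : `|f (c y) - f (c x) - L (c y - c x)| <= e1 * `|c y - c x|.
  have Ay : A (c y) by near: y.
  by move: Ay; near: y.
have n0 := normr_ge0 (y - x).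
have h3 : `|c y - c x| <= (k2 + 1) * `|y - x|.
  have t := ler_normD (c y - c x - 'd c x (y - x)) ('d c x (y - x)).
  rewrite subrK in t; have h4 := ck (y - x).
  have h5 : e2 * `|y - x| <= `|y - x| by rewrite ler_piMl// /e2 ge_min lexx.
  by lra.
have -> : f (c y) - f (c x) - L' (y - x) =
    (f (c y) - f (c x) - L (c y - c x)) + L (c y - c x - 'd c x (y - x)).
  rewrite (linearB L (c y - c x) ('d c x (y - x))) -[L' (y - x)]/(L ('d c x (y - x))).
  by ring.
rewrite (le_trans (ler_normD _ _))// [e]splitr mulrDl lerD//.
  rewrite (le_trans h2)//.
  rewrite (le_trans (ler_wpM2l (ltW e10) h3))// mulrA /e1.
  rewrite (_ : e / (2 * (k2 + 1)) * (k2 + 1) = e / 2)//; field; lra.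
rewrite (le_trans (Lk _))// (le_trans (ler_wpM2l (ltW k10) h1))// mulrA.
rewrite ler_wpM2r//.
have -> : e / 2 = k1 * (e / (2 * k1)) by field; lra.
by apply: ler_wpM2l; [exact: ltW|rewrite /e2 ge_min lexx orbT].
Unshelve. all: by end_near. Qed.

Lemma omega_linear (x : 'rV[R]_2) : linear (omega x).
Proof. by move=> k u v; rewrite /omega !mxE -[_ *: _]/(_ * _); ring. Qed.

Definition omegaL (x : 'rV[R]_2) : {linear 'rV[R]_2 -> R} :=
  HB.pack (omega x) (GRing.isLinear.Build _ _ _ _ _ (omega_linear x)).

Lemma continuous_omega (x : 'rV[R]_2) : continuous (omega x).
Proof.
move=> v; apply: (@Ck_continuous _ _ setT) => // k; have o := @openT 'rV[R]_2.
by rewrite /omega; ck o.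
Qed.

Definition turn (t : R) (p : 'rV[R]_2) : 'rV[R]_2 :=
  rv2 (cos t * p 0 0 - sin t * p 0 1) (sin t * p 0 0 + cos t * p 0 1).

Lemma dot_turn t p : dot (turn t p) (turn t p) = dot p p.
Proof.
rewrite !dot2E !rvE.
transitivity ((cos t ^+ 2 + sin t ^+ 2) * (p 0 0 * p 0 0 + p 0 1 * p 0 1)); first by ring.
by rewrite cos2Dsin2 mul1r.
Qed.

Lemma turnK t p : turn t (turn (- t) p) = p.
Proof.
have cs := cos2Dsin2 t.
apply: eq_rv2; rewrite !rvE cosN sinN.
  by transitivity ((cos t ^+ 2 + sin t ^+ 2) * p 0 0); [ring|rewrite cs mul1r].
by transitivity ((cos t ^+ 2 + sin t ^+ 2) * p 0 1); [ring|rewrite cs mul1r].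
Qed.

Lemma turnNK t p : turn (- t) (turn t p) = p.
Proof. by rewrite -{2}[t]opprK turnK. Qed.

Definition quarter (p : 'rV[R]_2) : 'rV[R]_2 := rv2 (- p 0 1) (p 0 0).

Lemma is_derive_turn0 p : is_derive (0 : R) (1 : R) (turn^~ p) (quarter p).
Proof.
have [dc ds] := (is_derive_cos (0 : R), is_derive_sin (0 : R)).
have [c0 c1] := (is_derive_cst (p 0 0) (0 : R) (1 : R), is_derive_cst (p 0 1) (0 : R) (1 : R)).
apply: is_derive_rv2.
  apply: (is_derive_eq (is_derive_sub (is_derive_mul dc c0) (is_derive_mul ds c1))).
  by rewrite /cst cos0 sin0; ring.
apply: (is_derive_eq (is_derive_add (is_derive_mul ds c0) (is_derive_mul dc c1))).
by rewrite /cst cos0 sin0; ring.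
Qed.

Lemma is_derive_turn t (p v : 'rV[R]_2) : is_derive p v (turn t) (turn t v).
Proof.
have E i := is_derive_entry p v i.
have [dc ds] := (is_derive_cst (cos t) p v, is_derive_cst (sin t) p v).
by apply: is_derive_rv2.
Qed.

Lemma Ck_turn (V : normedModType R) k (U : set V) (t : V -> R) (p : V -> 'rV[R]_2) :
  open U -> Ck k U t -> Ck k U p -> Ck k U (fun x => turn (t x) (p x)).
Proof.
move=> oU tU pU; have [cT sT] := @smooth_trig R k.
have cU : Ck k U (fun x => cos (t x)) by exact: (Ck_comp1 oU _ cT tU).
have sU : Ck k U (fun x => sin (t x)) by exact: (Ck_comp1 oU _ sT tU).
have eU i : Ck k U (fun x => p x 0 i) by exact: Ck_coord.
by apply: Ck_rv2 => //; [apply: (CkB oU)|apply: (CkD oU)]; exact: (CkM oU).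
Qed.

(** Half the sum of [x^2] and [x |x|] is [max(0, x)^2]; this rule differentiates it without a case
    distinction at 0. *)
Lemma is_derive_mulnorm (x : R) : is_derive x (1 : R) (fun x : R => x * `|x|) (2 * `|x|).
Proof.
have [x0|x0|<-] := ltgtP 0 x.
- apply: (@near_eq_is_derive _ _ _ (fun z : R => z * z)).
    by near=> z; rewrite gtr0_norm//; near: z; exact: lt_nbhsr.
  apply: (is_derive_eq (is_derive_mul (is_derive_id x 1) (is_derive_id x 1))).
  by rewrite gtr0_norm//; ring.
- apply: (@near_eq_is_derive _ _ _ (fun z : R => - (z * z))).
    by near=> z; rewrite ltr0_norm ?mulrN//; near: z; exact: lt_nbhsl.
  apply: (is_derive_eq (is_derive_opp (is_derive_mul (is_derive_id x 1) (is_derive_id x 1)))).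
  by rewrite ltr0_norm//; ring.
- apply/is_derive1_caratheodory; exists (fun z : R => `|z|); split.
  + by move=> z; rewrite normr0 !mul0r !subr0 mulrC.
  + exact: norm_continuous.
  + by rewrite normr0 mulr0.
Unshelve. all: by end_near. Qed.

End WithinDisc.

Section Twist.
Context {R : realType} (H : R -> 'rV[R]_2 -> R).
Context (X phi : R -> 'rV[R]_2 -> 'rV[R]_2) (e : R) (h : R -> R).
Let H' (z : R * 'rV[R]_2) : R := H z.1 z.2.
Let W : set (R * 'rV[R]_2) := [set z | open_disc z.2].
Context (Hsm : smooth_on [set z : R * 'rV[R]_2 | disc z.2] H').
Context (Hper : forall s p, disc p -> H (s + 2 * pi) p = H s p).
Context (HX : hamiltonian_vector_field H X) (e0 : 0 < e) (e1 : e < 1).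
Context (Hbd : forall s p, disc p -> 1 - e < Defs.radius p -> H s p = h (Defs.radius p)).
Context (phid : forall s, diffeo_disc (phi s)).
Context (phi0 : forall p, disc p -> phi 0 p = p).
Context (dphi : forall s p, disc p ->
  is_derive s (1 : R) (phi^~ p) (X s (phi s p))).

Let oW : open W.
Proof.
apply: (@open_comp _ _ (snd : R * 'rV[R]_2 -> 'rV[R]_2) (@open_disc R)); last exact: open_open_disc.
by move=> z _; exact: cvg_snd.
Qed.

Let HW : smooth W H'.
Proof. by apply: smooth_on_smooth Hsm oW _ => z; exact: open_discW. Qed.

Lemma radius_turn t (p : 'rV[R]_2) : Defs.radius (turn t p) = Defs.radius p.
Proof. by rewrite /Defs.radius dot_turn. Qed.

Lemma disc_turn t (p : 'rV[R]_2) : disc (turn t p) = disc p.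
Proof. by rewrite /disc/= dot_turn. Qed.

Lemma open_disc_turn t (p : 'rV[R]_2) : open_disc (turn t p) = open_disc p.
Proof. by rewrite /open_disc/= dot_turn. Qed.

(* H is constant along the circle through p, so dH kills its tangent. *)
Let tangential s p : disc p -> 1 - e < Defs.radius p -> dot p (X s p) = 0.
Proof.
move=> p1 pe.
have dr := is_derive_turn0 p.
have /derivable1_diffP dfr : derivable (turn^~ p) (0 : R) 1 by exact: ex_derive.
have r0 : turn 0 p = p by apply: eq_rv2; rewrite !rvE cos0 sin0; ring.
have HXp : is_diff_within disc (H s) (turn 0 p) (omegaL (X s p)).
  by rewrite r0; exact: HX.
have [|dH DH] := @diff_within_comp _ _ _ _ _ (omegaL (X s p)) (turn^~ p) 0
    (@continuous_omega R (X s p)) HXp _ dfr.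
  by near=> t; rewrite disc_turn.
have : 'd (fun t => H s (turn t p)) 0 (1 : R) = 0.
  rewrite (_ : (fun t => _) = cst (H s p)) ?diff_cst//.
  by apply/funext => t; rewrite /= !Hbd ?disc_turn// radius_turn.
rewrite DH -deriveE// (@derive_val _ _ _ _ _ _ _ dr).
by rewrite /= /omega !rvE dot2E => ?; lra.
Unshelve. all: by end_near. Qed.

Let near_disc (p : 'rV[R]_2) : open_disc p -> \forall q \near p, open_disc q.
Proof. by move=> p1; apply: open_nbhs_nbhs; split=> //; exact: open_open_disc. Qed.

Let H_diff s p : open_disc p ->
  differentiable (H s) p /\ forall v, 'd (H s) p v = omega (X s p) v.
Proof.
move=> p1; have did : differentiable (id : 'rV[R]_2 -> 'rV[R]_2) p by [].
have := @diff_within_comp _ _ _ _ (H s) (omegaL (X s p)) id p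
    (@continuous_omega R (X s p)) (HX s (open_discW p1)) _ did.
case; first by apply: filterS (near_disc p1) => q; exact: open_discW.
by move=> dH DH; split=> // v; rewrite DH -(deriveE _ did) derive_id.
Qed.

Let X_per s p : open_disc p -> X (s + 2 * pi) p = X s p.
Proof.
move=> p1.
have E v : omega (X (s + 2 * pi) p) v = omega (X s p) v.
  have [d1 <-] := H_diff (s + 2 * pi) p1; have [d2 <-] := H_diff s p1.
  rewrite -!deriveE//; apply: near_eq_derive.
  by apply: filterS (near_disc p1) => q /open_discW; exact: Hper.
have E0 := E (rv2 1 0); have E1 := E (rv2 0 1).
by rewrite /omega !rvE in E0 E1; apply: eq_rv2; lra.
Qed.

(** The given [h] has no regularity. A local smooth extension of [H] at the boundary point [(1, 0)]
    and time 0, restricted to the first axis, is smooth across [x = 1] and agrees with [H] in a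
    possibly thinner collar, because there [H] depends on the radius alone. *)
Let profile : exists (hb : R -> R) (r : R), [/\ 0 < r,
  smooth [set x | `|x - 1| < r] hb
  & forall s p, disc p -> 1 - r < Defs.radius p -> H s p = hb (Defs.radius p)].
Proof.
have cd : [set z : R * 'rV[R]_2 | disc z.2] (0, rv2 1 0).
  by rewrite /disc/= dot2E !rvE; lra.
have [U [g [oU U0 gU gH]]] := Hsm cd.
pose c (x : R) : R * 'rV[R]_2 := (0, rv2 x 0).
have oT := @openT R.
have crv (k : nat) : Ck k setT (fun x : R => rv2 x 0).
  by apply: Ck_rv2 => //; [exact: Ck_id|exact: Ck_cst].
have cc : continuous c.
  move=> x; have c2 : {for x, continuous (fun x : R => rv2 x 0)} by exact: (crv 0%N x).
  exact: (cvg_pair (cvg_cst (0 : R)) c2).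
have : nbhs (1 : R) (c @^-1` U).
  by apply: cc; apply: open_nbhs_nbhs; split.
move=> /nbhs_ballP[r /= r0 rU].
have oI : open [set x : R | `|x - 1| < r].
  rewrite (_ : [set _ | _] = ball (1 : R) r); first exact: ball_open.
  by apply/seteqP; split=> x; rewrite -ball_normE/= distrC.
have IU x : `|x - 1| < r -> U (c x).
  by move=> xr; apply: rU; rewrite -ball_normE/= distrC.
exists (fun x => g (c x)), (Num.min r e); split; first by rewrite lt_min r0.
  move=> k; apply: (@Ck_sub _ _ _ _ _ [set x : R | `|x - 1| < r]).
    by move=> x /=; rewrite lt_min => /andP[].
  apply: (@Ck_comp_pair _ _ _ _ _ U g (fun=> 0) (fun x => rv2 x 0) oI) => //.
    exact: Ck_cst.
  by apply: Ck_sub (crv k).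
move=> s p p1 pr.
have pe : 1 - e < Defs.radius p.
  by apply: le_lt_trans pr; rewrite lerD2l lerN2 ge_min lexx orbT.
have prr : 1 - r < Defs.radius p.
  by apply: le_lt_trans pr; rewrite lerD2l lerN2 ge_min lexx.
have rp1 : Defs.radius p <= 1 by rewrite -sqrtr1 ler_wsqrtr.
have rp0 : 0 <= Defs.radius p by rewrite sqrtr_ge0.
have rr : Defs.radius (rv2 (Defs.radius p) 0) = Defs.radius p.
  by rewrite {1}/Defs.radius dot2E !rvE mul0r addr0 -expr2 sqrtr_sqr ger0_norm.
have d1 : disc (rv2 (Defs.radius p) 0).
  by rewrite /disc/= dot2E !rvE mul0r addr0; apply: mulr_ile1.
rewrite gH//; last by apply: IU; rewrite ltr_norml; lra.
by rewrite /H'/= !Hbd// ?rr.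
Qed.

(** * A uniform bound on [H + lambda(X)] *)

Let mass s p := H s p + lambda p (X s p).

Let massE s p : open_disc p -> mass s p =
  H' (s, p) - (p 0 0 * 'D_(0, rv2 1 0) H' (s, p) + p 0 1 * 'D_(0, rv2 0 1) H' (s, p)) / 2.
Proof.
move=> p1; rewrite !derive_slice; have [dH DH] := H_diff s p1.
by rewrite !(deriveE _ dH) !DH /mass /omega /lambda !rvE /H'/=; field.
Qed.

(** Over the open disc the quantity is a continuous expression in [H] and its first derivatives.
    Near a boundary point the same expression in a local extension of [H] is bounded, so compactness
    of [[0, 2 pi]] times the closed disc applies; periodicity covers the other times. *)
Let mass_bounded : exists M : R, forall s p, open_disc p -> `|mass s p| <= M.
Proof.
suff [M MB] : exists M : R, forall s p, 0 <= s <= 2 * pi -> open_disc p -> `|mass s p| <= M.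
  exists M => s p p1; have [n /andP[n0 n2]] := mod2pi s.
  rewrite -(@periodic_int _ _ (mass^~ p) (2 * pi) (- n) s).
    by apply: MB => //; rewrite mulrNz mulNr n0 ltW.
  by move=> t; rewrite /mass Hper ?X_per//; exact: open_discW.
have cC : compact ([set` `[(0 : R), 2 * pi]] `*` (@disc R)).
  by apply: compact_setX; [exact: segment_compact|exact: compact_disc].
have /compact_near_coveringP/(_ R +oo (fun M z => W z -> `|mass z.1 z.2| <= M) _) := cC.
case.
  move=> z [_ zd].
  have [U [g [oU Uz gU gH]]] := Hsm zd.
  (* The right-hand side of [massE] for the extension [g], which is continuous at [z] even when [z]
     lies over the boundary circle. *)
  pose Eg (y : R * 'rV[R]_2) := g y - (y.2 0 0 * 'D_(0, rv2 1 0) g y +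
    y.2 0 1 * 'D_(0, rv2 0 1) g y) / 2.
  have [_ Dg] := gU 1.
  have cEg : {for z, continuous Eg}.
    have cent i : {for z, continuous (fun y : R * 'rV[R]_2 => y.2 0 i)}.
      apply: (@continuous_comp _ _ _ snd (fun v : 'rV[R]_2 => v 0 i)).
        exact: cvg_snd.
      exact: coord_continuous.
    have c0 := Dg (0, rv2 1 0) z Uz; have c1 := Dg (0, rv2 0 1) z Uz.
    exact: (cvgB (gU 0%N z Uz) (cvgM (cvgD (cvgM (cent 0) c0) (cvgM (cent 1) c1)) (cvg_cst _))).
  have : \forall y \near z, U y /\ `|Eg y| <= `|Eg z| + 1.
    near=> y; split; first by near: y; exact: open_nbhs_nbhs.
    have : `|Eg z - Eg y| <= 1.
      by near: y; move/cvgrPdist_le : cEg; apply.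
    have := ler_normB (Eg z) (Eg z - Eg y).
    by rewrite opprB addrC subrK; lra.
  move=> nz; exists ([set y | U y /\ `|Eg y| <= `|Eg z| + 1], [set M | `|Eg z| + 1 <= M]).
    by split=> //=; exact: nbhs_pinfty_ge.
  move=> [[s p] M] [/= [Uy Ey] MM] Wy.
  rewrite (le_trans _ MM)// (le_trans _ Ey)// massE//.
  have oUW : open (U `&` W) by exact: openI.
  have nUW : \forall y \near ((s, p) : R * 'rV[R]_2), H' y = g y.
    have : \forall y \near ((s, p) : R * 'rV[R]_2), (U `&` W) y by apply: open_nbhs_nbhs.
    by apply: filterS => y [Uy' Wy']; rewrite gH//; exact: open_discW.
  by rewrite /Eg (near_eq_derive _ nUW) (near_eq_derive _ nUW) (nbhs_singleton nUW).
move=> M [_ MB]; exists (M + 1) => s p s01 p1.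
by apply: (MB (M + 1) _ (s, p)); [rewrite ltrDl|split=> /=; [rewrite in_itv/=|exact: open_discW]|].
Unshelve. all: by end_near.
Qed.

(* [cut q = max(0, q - (1 - e)^2)^2], which is constant along orbits because
   the vector field is tangent to the circles where [cut'] is nonzero. *)
Let cut (q : R) : R :=
  ((q - (1 - e) ^+ 2) ^+ 2 + (q - (1 - e) ^+ 2) * `|q - (1 - e) ^+ 2|) / 2.

Let phi_disc s p : disc p -> disc (phi s p).
Proof. by have [phi' [_ _ H1 _]] := phid s => /H1[]. Qed.

(** Outside the collar [|phi|^2] need not be conserved. Cutting it off gives a quantity conserved on
    whole orbits, so no argument about the times of entering and leaving the collar is required. *)
Let cut_phi s p : disc p -> cut (dot (phi s p) (phi s p)) = cut (dot p p).
Proof.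
move=> p1; set a := (1 - e) ^+ 2.
pose q t := dot (phi t p) (phi t p).
suff : cut (q s) = cut (q 0) by rewrite /q phi0.
apply: (@is_derive_0_is_cst R (fun t => cut (q t))) => t.
have dq : is_derive t (1 : R) q (2 * dot (phi t p) (X t (phi t p))).
  exact: (is_derive_dot2 (dphi t p1)).
have dqa := is_derive_sub dq (is_derive_cst a t (1 : R)).
have dm := @is_derive_chain _ _ (fun x : R => x * `|x|) (fun t => q t - a) t _ _
  (is_derive_mulnorm _) dqa.
have dc := is_derive_mul (is_derive_add (is_derive_exp 2 dqa) dm)
  (is_derive_cst (2^-1 : R) t (1 : R)).
apply: (is_derive_eq dc).
rewrite /cst mulr0 add0r subr0 /= expr1 -[_ *: _]/(_ * _).
(* The derivative is [(q - a + |q - a|) q']: the first factor vanishes for [q <= a], and [q']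
   vanishes by tangency for [q > a]. *)
have [qa|qa] := leP (q t) a.
  by rewrite ler0_norm ?subr_le0//; ring.
have -> : dot (phi t p) (X t (phi t p)) = 0; last by ring.
apply: tangential; first exact: phi_disc.
have e10 : 0 <= 1 - e by rewrite subr_ge0 ltW.
rewrite /Defs.radius -[ltLHS]ger0_norm// -sqrtr_sqr ltr_sqrt//.
by apply: le_lt_trans qa; exact: sqr_ge0.
Qed.

Let cut_lt1 (q : R) : 0 <= q -> q < 1 -> cut q < cut 1.
Proof.
move=> q0 q1; rewrite /cut; set a := (1 - e) ^+ 2.
have a1 : a < 1 by rewrite /a expr_lt1 ?subr_ge0 ?ltW// ltrBlDr ltrDl.
rewrite (@gtr0_norm _ (1 - a)) ?subr_gt0//.
have [qa|qa] := leP q a.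
  by rewrite ler0_norm ?subr_le0//; nra.
by rewrite gtr0_norm ?subr_gt0//; nra.
Qed.

Let dot_ge0 (p : 'rV[R]_2) : 0 <= dot p p.
Proof. by rewrite dot2E; nra. Qed.

(** On [[0, 1]] the function [cut] takes its value at 1 only at 1, so its conservation separates
    interior orbits from boundary orbits. *)
Let phi_open s p : disc p -> open_disc (phi s p) <-> open_disc p.
Proof.
move=> p1; have cE := cut_phi s p1; have d1 := phi_disc s p1.
have cases (x : 'rV[R]_2) : disc x -> open_disc x \/ dot x x = 1.
  by rewrite /disc/= le_eqVlt => /predU1P[|]; [right|left].
split=> o1.
  have [//|c1] := cases p p1.
  by have := cut_lt1 (dot_ge0 _) o1; rewrite cE c1 ltxx.
have [//|c1] := cases _ d1.
by have := cut_lt1 (dot_ge0 _) o1; rewrite -cE c1 ltxx.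
Qed.

Let phi_surj s q : open_disc q -> exists2 p, open_disc p & phi s p = q.
Proof.
move=> q1; have [phi' [_ _ _ H2]] := phid s.
have [p1 pq] := H2 q (open_discW q1).
by exists (phi' q) => //; apply/(phi_open s p1); rewrite pq.
Qed.

(** * Choice of the twist and verification for the twisted data *)

Theorem radial_hamiltonian_embeds (psi : 'rV[R]_2 -> 'rV[R]_2) :
  (forall p, disc p -> psi p = phi (2 * pi) p) ->
  embeds_into_Reeb_flow_on_S3 psi.
Proof.
move=> psiE.
have [hb [r [r0 hbI Hhb]]] := profile.
have [M MB] := mass_bounded.
(* Subtracting the boundary value [c] makes [K] vanish at the boundary; [c'] enters through
   [f'(0) = N - c' / 2]. *)
pose c := hb 1; pose c' := 'D_1 hb 1.
(* This size gives [N - |M| - |c| > 1], which yields the lower bound [m0 = 1] for [K + lambda(X)],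
   and also [f'(0) > 0]. That [N] is a natural number closes the rotation up at [s = 2 pi]. *)
pose n := Num.bound (`|M| + `|c| + `|c'| + 1); pose N : R := n%:R.
have NP : `|M| + `|c| + `|c'| + 1 < N.
  by apply: archi_boundP; rewrite !addr_ge0.
have hM := ler_norm M; have hc := ler_norm c; have hc' := ler_norm c'.
have hM0 := normr_ge0 M; have hc0 := normr_ge0 c; have hc'0 := normr_ge0 c'.
pose K (s : R) (p : 'rV[R]_2) : R := N * (1 - dot p p) + H s (turn (- (N * s)) p) - c.
pose Xt (s : R) (p : 'rV[R]_2) : 'rV[R]_2 :=
  N *: quarter p + turn (N * s) (X s (turn (- (N * s)) p)).
pose phit (s : R) (p : 'rV[R]_2) : 'rV[R]_2 := turn (N * s) (phi s p).
pose f (t : R) : R := N * t + hb (Num.sqrt (1 - t)) - c.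
(* The bound by 1 keeps [1 - t] positive under the root. The bound by [r] keeps the root in the
   domain of [hb], since [|sqrt (1 - t) - 1| <= |t|]. *)
pose d := Num.min r 1.
have d0 : 0 < d by rewrite lt_min r0 ltr01.
have sqrt_near (t : R) : `|t| < d -> 0 < 1 - t /\ `|Num.sqrt (1 - t) - 1| < r.
  rewrite lt_min => /andP[tr t1].
  have t0 : 0 < 1 - t by move: t1; rewrite ltr_norml; lra.
  split=> //; have s0 : 0 <= Num.sqrt (1 - t) by rewrite sqrtr_ge0.
  have st : (Num.sqrt (1 - t) - 1) * (Num.sqrt (1 - t) + 1) = - t.
    rewrite (_ : _ * _ = Num.sqrt (1 - t) ^+ 2 - 1); last by ring.
    by rewrite sqr_sqrtr ?ltW//; ring.
  have tE : `|t| = `|Num.sqrt (1 - t) - 1| * `|Num.sqrt (1 - t) + 1|.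
    by rewrite -normrM st normrN.
  apply: le_lt_trans tr; rewrite tE.
  by rewrite ler_peMr// ger0_norm; lra.
have oI : open [set x : R | `|x| < d].
  rewrite (_ : [set _ | _] = ball (0 : R) d); first exact: ball_open.
  by apply/seteqP; split=> x; rewrite -ball_normE/= sub0r normrN.
have fI : smooth [set x | `|x| < d] f.
  move=> k; apply: (CkB oI); last exact: Ck_cst.
  apply: (CkD oI); first by apply: (CkM oI); [exact: Ck_cst|exact: Ck_id].
  apply: (Ck_comp1 oI _ (hbI k)) => [x /sqrt_near[]//|].
  apply: (Ck_comp1 oI _ (smooth_sqrt k)) => [x /sqrt_near[]//|].
  by apply: (CkB oI); [exact: Ck_cst|exact: Ck_id].
have f0 : f 0 = 0 by rewrite /f subr0 sqrtr1 mulr0 add0r subrr.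
have f'0 : 0 < 'D_1 f 0.
  have hb1 : is_derive (Num.sqrt (1 - 0) : R) (1 : R) hb c'.
    rewrite subr0 sqrtr1; split=> //; apply/derivable1_diffP.
    by have [+ _] := hbI 1%N; apply; rewrite /= subrr normr0.
  have d1 := is_derive_sub (is_derive_cst (1 : R) (0 : R) 1) (is_derive_id (0 : R) 1).
  have d2 := @is_derive_chain _ _ Num.sqrt (fun t : R => 1 - t) 0 _ _
    (is_derive1_sqrt (_ : 0 < 1 - 0)) d1.
  have pos1 : (0 : R) < 1 - 0 by rewrite subr0.
  have d3 := @is_derive_chain _ _ hb (fun t : R => Num.sqrt (1 - t)) 0 _ _ hb1 (d2 pos1).
  have d4 := is_derive_mul (is_derive_cst N (0 : R) 1) (is_derive_id (0 : R) 1).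
  have d5 := is_derive_sub (is_derive_add d4 d3) (is_derive_cst c (0 : R) 1).
  rewrite (@derive_val _ _ _ _ _ _ _ d5) /cst !subr0 sqrtr1 -![_ *: _]/(_ * _).
  have -> : N * 1 + 0 * 0 + (0 - 1) * (2 * 1)^-1 * c' = N - c' / 2 :> R by field.
  by lra.
have turn_arg s (p : 'rV[R]_2) : turn (N * (s + 2 * pi)) p = turn (N * s) p.
  rewrite /turn mulrDr (_ : N * (2 * pi) = (pi *+ 2) *+ n).
    by rewrite (periodicn (@cosD2pi R)) (periodicn (@sinD2pi R)).
  by rewrite -[RHS]mulr_natl -[pi *+ 2]mulr_natl.
have turn_argN s (p : 'rV[R]_2) : turn (- (N * (s + 2 * pi))) p = turn (- (N * s)) p.
  rewrite -[LHS](turnNK (N * s)) -{1}(turn_arg s).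
  by rewrite turnK.
have pi_od s (p : 'rV[R]_2) : open_disc p -> open_disc (turn s p) by rewrite open_disc_turn.
apply: (@mapping_torus_embeds R K Xt f d _ _ _ d0 fI f0 _ f'0 1 ltr01 _ phit).
- move=> k.
  have cf : Ck k W (fun z : R * 'rV[R]_2 => z.1).
    apply: (@Ck_linear _ _ _ k W (fst : {linear (R * 'rV[R]_2)%type -> R^o})).
    by move=> z; exact: cvg_fst.
  have cs : Ck k W (fun z : R * 'rV[R]_2 => z.2).
    apply: (@Ck_linear _ _ _ k W (snd : {linear (R * 'rV[R]_2)%type -> 'rV[R]_2})).
    by move=> z; exact: cvg_snd.
  have ce i : Ck k W (fun z : R * 'rV[R]_2 => z.2 0 i) by exact: (Ck_coord i oW cs).
  have ca : Ck k W (fun z : R * 'rV[R]_2 => - (N * z.1)).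
    by apply: (CkN oW); apply: (CkM oW) => //; exact: Ck_cst.
  have ct := Ck_turn oW ca cs.
  apply: (@Ck_eq _ _ _ _ _ (fun z : R * 'rV[R]_2 =>
    N * (1 - (z.2 0 0 * z.2 0 0 + z.2 0 1 * z.2 0 1)) +
    H' (z.1, turn (- (N * z.1)) z.2) - c)) => //.
    by move=> z _; rewrite /K dot2E.
  apply: (CkB oW); last exact: Ck_cst.
  apply: (CkD oW).
    apply: (CkM oW); first exact: Ck_cst.
    apply: (CkB oW); first exact: Ck_cst.
    by apply: (CkD oW); apply: (CkM oW); exact: ce.
  apply: (Ck_comp_pair oW _ (HW k) cf ct) => z z1.
  exact: pi_od.
- move=> s p p1; rewrite /K turn_argN Hper// disc_turn; exact: open_discW.
- move=> s p v p1; rewrite derive_slice.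
  have pd := pi_od (- (N * s)) p p1; have [dH DH] := H_diff s pd.
  have oT := @openT 'rV[R]_2.
  have dT : differentiable (turn (- (N * s))) p.
    have cT : Ck 1 setT (fun q : 'rV[R]_2 => turn (- (N * s)) q).
      by apply: (Ck_turn oT); [exact: Ck_cst|exact: Ck_id].
    by have [+ _] := cT; exact.
  have dHT : differentiable (H s \o turn (- (N * s))) p by exact: differentiable_comp.
  have d1 : is_derive p v (fun q => H s (turn (- (N * s)) q))
      (omega (X s (turn (- (N * s)) p)) (turn (- (N * s)) v)).
    split; first exact: (diff_derivable dHT).
    rewrite -[LHS]/('D_v (H s \o turn (- (N * s))) p) (deriveE _ dHT) (diff_comp dT dH)/= DH.
    rewrite -(deriveE _ dT).
    by rewrite (@derive_val _ _ _ _ _ _ _ (is_derive_turn (- (N * s)) p v)).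
  have d2 := is_derive_sub (is_derive_cst (1 : R) p v) (is_derive_dot2 (is_derive_id p v)).
  have d3 := is_derive_add (is_derive_mul (is_derive_cst N p v) d2) d1.
  have d4 := is_derive_sub d3 (is_derive_cst c p v).
  rewrite (@derive_val _ _ _ _ _ _ _ d4) /cst /omega /Xt /quarter /turn dot2E.
  by rewrite !mxE/= cosN sinN; ring.
- move=> s p p1 pd; have q0 : 0 < 1 - dot p p by rewrite subr_gt0.
  have /sqrt_near[_] : `|1 - dot p p| < d by rewrite gtr0_norm.
  have e2 : 1 - (1 - dot p p) = dot p p by ring.
  rewrite e2 => sq.
  rewrite /K /f e2 -[Num.sqrt _]/(Defs.radius p).
  rewrite -(radius_turn (- (N * s))) Hhb ?disc_turn ?radius_turn//.
    exact: open_discW.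
  by move: sq; rewrite -/(Defs.radius p) ltr_norml; lra.
- move=> s p p1.
  have pd := pi_od (- (N * s)) p p1.
  have := MB s _ pd; rewrite ler_norml /mass => /andP[mb _].
  (* The rotation contributes [N r^2] through [lambda], completing [N (1 - r^2)] to [N]; the other
     [lambda] term is carried back by rotation invariance. *)
  have -> : K s p + lambda p (Xt s p) = N +
      (H s (turn (- (N * s)) p) +
       lambda (turn (- (N * s)) p) (X s (turn (- (N * s)) p))) - c.
    rewrite /K /Xt /lambda /quarter; set p' := turn (- _) _; set x := X s p'.
    have -> : p' 0 0 * x 0 1 - p' 0 1 * x 0 0 =
        p 0 0 * turn (N * s) x 0 1 - p 0 1 * turn (N * s) x 0 0.
      by rewrite /p' !rvE cosN sinN; ring.
    by rewrite dot2E !mxE/=; ring.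
  by lra.
- move=> s p p1; rewrite /phit open_disc_turn; apply/phi_open => //; exact: open_discW.
- move=> p p1; rewrite /phit mulr0 phi0; last exact: open_discW.
  by apply: eq_rv2; rewrite !rvE cos0 sin0; ring.
- move=> s q q1; have [p p1 pq] := phi_surj s (pi_od (- (N * s)) q q1).
  by exists p => //; rewrite /phit pq turnK.
- move=> s p p1; have p1' := open_discW p1.
  have dt : is_derive s (1 : R) (fun s => N * s) N.
    apply: (is_derive_eq (is_derive_mul (is_derive_cst N s (1 : R)) (is_derive_id s (1 : R)))).
    by rewrite /cst mulr0 addr0 mulr1.
  have E i := is_derive_coord (dphi s p1') i.
  have dc := @is_derive_chain _ _ cos _ _ _ _ (is_derive_cos (N * s)) dt.
  have ds := @is_derive_chain _ _ sin _ _ _ _ (is_derive_sin (N * s)) dt.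
  rewrite /Xt /phit turnNK; apply: is_derive_rV; apply: ord2P.
    under eq_fun do rewrite rv20.
    apply: (is_derive_eq (is_derive_sub (is_derive_mul dc (E 0)) (is_derive_mul ds (E 1)))).
    by rewrite !mxE/= -![_ *: _]/(_ * _); ring.
  under eq_fun do rewrite rv21.
  apply: (is_derive_eq (is_derive_add (is_derive_mul ds (E 0)) (is_derive_mul dc (E 1)))).
  by rewrite !mxE/= -![_ *: _]/(_ * _); ring.
- move=> p p1; rewrite psiE; last exact: open_discW.
  rewrite /phit -[2 * pi]add0r turn_arg mulr0 add0r.
  by apply: eq_rv2; rewrite !rvE cos0 sin0; ring.
Qed.

End Twist.

Theorem proposition1p6 (R : realType) (H : R -> 'rV[R]_2 -> R)
    (phi : R -> 'rV[R]_2 -> 'rV[R]_2) (psi : 'rV[R]_2 -> 'rV[R]_2)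
    (hH : smooth_periodic_hamiltonian H)
    (hphi : hamiltonian_isotopy H phi)
    (hpsi : forall p, disc p -> psi p = phi (2 * pi) p)
    (hbd : autonomous_radial_near_boundary H) :
  embeds_into_Reeb_flow_on_S3 psi.
Proof.
have [Hsm Hper] := hH.
have [_ phid phi0 [X HX dphi]] := hphi.
have [e [h [e0 e1 Hbd]]] := hbd.
exact: (@radial_hamiltonian_embeds R H X phi e h).
Qed.
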